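(* There exists an absolute constant $C>0$ such that for every $n\ge 2$ and every isotropic log-concave probability measure $\mu$ on $\mathbb{R}^n$ with density $f=e^{-\psi}$ satisfying $f(0)=\|f\|_\infty$, $$\int_{G_{n,n-1}}\|P_Ef\|_1\,d\nu_{n,n-1}(E)\le C\sqrt{n}.$$
   Context: $G_{n,n-1}$ is the Grassmann manifold of $(n-1)$-dimensional linear subspaces of $\mathbb{R}^n$ and $\nu_{n,n-1}$ its rotation-invariant (Haar) probability measure. For $E\in G_{n,n-1}$, the projection of $f$ onto $E$ is the function on $E$ given by $P_Ef(x)=\sup\{f(x+y):y\in E^\perp\}$, $x\in E$, where $E^\perp$ is the orthogonal complement, and $\|P_Ef\|_1=\int_E P_Ef(x)\,dx$ with respect to $(n-1)$-dimensional Lebesgue measure on $E$. A log-concave probability measure has a density $f=e^{-\psi}$ with $\psi:\mathbb{R}^n\to(-\infty,\infty]$ convex; it is isotropic if $\int x f(x)\,dx=0$ and $\int x\otimes x\,f(x)\,dx=I_n$. *)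

(* Defs.v *)
From HB Require Import structures.
From mathcomp Require Import all_boot all_order all_algebra.
From mathcomp Require Import all_classical all_reals all_analysis.
From mathcomp Require Import measurable_realfun.

Set Implicit Arguments.
Unset Strict Implicit.
Unset Printing Implicit Defensive.

Import Order.TTheory GRing.Theory Num.Theory.
Import numFieldNormedType.Exports.

Local Open Scope classical_set_scope.
Local Open Scope ring_scope.

Definition rV_display : measure_display -> measure_display.
Proof. exact. Qed.

(* As for n.-tuple, 'rV_n carries the product sigma-algebra, generated by the
   coordinates; over a realType this is the Borel sigma-algebra of R^n. *)
Section measurable_rV.
Context {R : realType} (n : nat).

Let coors : 'I_n -> 'rV[R]_n -> R := fun i x => x ord0 i.

Let rV_set0 : g_sigma_preimage coors set0.
Proof. exact: sigma_algebra0. Qed.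

Let rV_setC A : g_sigma_preimage coors A -> g_sigma_preimage coors (~` A).
Proof. exact: sigma_algebraC. Qed.

Let rV_bigcup (F : _^nat) : (forall i, g_sigma_preimage coors (F i)) ->
  g_sigma_preimage coors (\bigcup_i (F i)).
Proof. exact: sigma_algebra_bigcup. Qed.

HB.instance Definition _ :=
  @isMeasurable.Build (rV_display R.-ocitv.-measurable.-sigma)
    'rV[R]_n (g_sigma_preimage coors) rV_set0 rV_setC rV_bigcup.

End measurable_rV.

Section measurable_rV_lemmas.
Context {R : realType}.

Lemma measurable_rV_coord n (i : 'I_n) :
  measurable_fun [set: 'rV[R]_n] (fun x : 'rV[R]_n => x ord0 i).
Proof.
move=> _ Y mY; rewrite setTI; apply: sub_sigma_algebra => /=.
rewrite -bigcup_seq/=; exists i => /=; first by rewrite mem_index_enum.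
by exists Y => //; rewrite setTI.
Qed.

Lemma measurable_fun_rVP d (T : measurableType d) n (f : T -> 'rV[R]_n) :
  measurable_fun [set: T] f <->
  forall i, measurable_fun [set: T] (fun t => f t ord0 i).
Proof.
split=> [mf i|mf].
  exact: measurableT_comp (measurable_rV_coord i) mf.
pose c i (x : 'rV[R]_n) := x ord0 i.
have sub : g_sigma_preimage (fun i => c i \o f) `<=` measurable.
  apply: smallest_sub; first exact: sigma_algebra_measurable.
  rewrite -bigcup_seq/= => A [i _ [B mB <-]]; rewrite setTI.
  by rewrite -[_ @^-1` _]setTI; exact: mf.
move=> _ A mA; rewrite setTI; apply: sub.
rewrite (g_sigma_preimage_comp c f).
by exists A => //; rewrite setTI.
Qed.

Lemma measurable_mulmx_rV m n (B : 'M[R]_(m, n)) :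
  measurable_fun [set: 'rV[R]_m] (fun u : 'rV[R]_m => u *m B).
Proof.
apply/measurable_fun_rVP => j.
under eq_fun do rewrite mxE.
apply: measurable_sum => i.
by apply: measurable_funM => //; exact: measurable_rV_coord.
Qed.

Definition rV_cons n (p : R * 'rV[R]_n) : 'rV[R]_(1 + n) :=
  row_mx (const_mx p.1) p.2.

Definition rV_uncons n (x : 'rV[R]_(1 + n)) : R * 'rV[R]_n :=
  (lsubmx x ord0 ord0, rsubmx x).

Lemma rV_consK n : cancel (@rV_cons n) (@rV_uncons n).
Proof.
by case=> a u; rewrite /rV_uncons /rV_cons row_mxKl row_mxKr mxE.
Qed.

Lemma measurable_rV_cons n :
  measurable_fun [set: R * 'rV[R]_n] (@rV_cons n).
Proof.
apply/measurable_fun_rVP => i; rewrite /rV_cons.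
have [j ->|j ->] := split_ordP i.
  under eq_fun do rewrite row_mxEl mxE.
  exact: measurable_fst.
under eq_fun do rewrite row_mxEr.
exact: measurableT_comp (measurable_rV_coord j) measurable_snd.
Qed.

Lemma measurable_rV_uncons n :
  measurable_fun [set: 'rV[R]_(1 + n)] (@rV_uncons n).
Proof.
apply: measurable_fun_pair.
  by under eq_fun do rewrite mxE; exact: measurable_rV_coord.
apply/measurable_fun_rVP => i.
under eq_fun do rewrite mxE.
exact: measurable_rV_coord.
Qed.

End measurable_rV_lemmas.

Section lebesgue_rV.
Local Open Scope ereal_scope.
Context {R : realType}.

Section lebesgue_rV_step.
Variable n : nat.
Variable m : {sigma_finite_measure set 'rV[R]_n -> \bar R}.

Definition lebesgue_rV_step : set 'rV[R]_(1 + n) -> \bar R :=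
  pushforward (lebesgue_measure \x m) (@rV_cons R n).

Let step0 : lebesgue_rV_step set0 = 0.
Proof. by rewrite /lebesgue_rV_step /pushforward preimage_set0 measure0. Qed.

Let step_ge0 A : 0 <= lebesgue_rV_step A.
Proof. by rewrite /lebesgue_rV_step /pushforward measure_ge0. Qed.

Let step_sigma_additive : semi_sigma_additive lebesgue_rV_step.
Proof.
have mc A : measurable A -> measurable (@rV_cons R n @^-1` A).
  by move=> mA; rewrite -[X in measurable X]setTI; exact: measurable_rV_cons.
move=> F mF tF mUF; rewrite /lebesgue_rV_step /pushforward preimage_bigcup.
apply: measure_semi_sigma_additive.
- by move=> k; exact: mc.
- apply/trivIsetP => /= i j _ _ ij; rewrite -preimage_setI.
  by move/trivIsetP : tF => /(_ _ _ _ _ ij) ->//; rewrite preimage_set0.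
- by rewrite -preimage_bigcup; exact: mc.
Qed.

HB.instance Definition _ := isMeasure.Build _ _ _ lebesgue_rV_step
  step0 step_ge0 step_sigma_additive.

Let step_sigma_finite : sigma_finite setT lebesgue_rV_step.
Proof.
have /sigma_finiteP[F [TF ndF Foo]] := sigma_finiteT (@lebesgue_measure R).
have /sigma_finiteP[G [TG ndG Goo]] := sigma_finiteT m.
exists (fun k => @rV_uncons R n @^-1` (F k `*` G k)).
  apply/esym/seteqP; split=> // x _.
  have [i _ Fi] : (\bigcup_i F i) (rV_uncons x).1 by rewrite -TF.
  have [j _ Gj] : (\bigcup_i G i) (rV_uncons x).2 by rewrite -TG.
  exists (maxn i j) => //; split.
    by move: Fi; exact/subsetPset/ndF/leq_maxl.
  by move: Gj; exact/subsetPset/ndG/leq_maxr.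
move=> k; have [mF Fk] := Foo k; have [mG Gk] := Goo k; split.
  rewrite -[X in measurable X]setTI; apply: measurable_rV_uncons => //.
  exact: measurableX.
rewrite /lebesgue_rV_step /pushforward -comp_preimage.
rewrite (_ : @rV_uncons R n \o @rV_cons R n = id) ?preimage_id; last first.
  by apply/funext => p; exact: rV_consK.
by rewrite product_measure1E// lte_mul_pinfty// ge0_fin_numE.
Qed.

HB.instance Definition _ := Measure_isSigmaFinite.Build _ _ _
  lebesgue_rV_step step_sigma_finite.

End lebesgue_rV_step.

Fixpoint lebesgue_rV n : {sigma_finite_measure set 'rV[R]_n -> \bar R} :=
  match n with
  | 0%N => dirac (0%R : 'rV[R]_0)
  | k.+1 => lebesgue_rV_step (lebesgue_rV k)
  end.

End lebesgue_rV.
Arguments lebesgue_rV R n : clear implicits.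

Definition dotp {R : realType} n (x y : 'rV[R]_n) : R := (x *m y^T) ord0 ord0.

Definition orthocomp {R : realType} n (E : {vspace 'rV[R]_n}) :
    set 'rV[R]_n :=
  [set y | forall x, x \in E -> dotp x y = 0].

Definition is_orthonormal_basis {R : realType} n (E : {vspace 'rV[R]_n})
    (B : 'M[R]_(\dim E, n)) : Prop :=
  B *m B^T = 1%:M /\ forall x : 'rV[R]_n, (x \in E) = (x <= B)%MS.

Definition onb {R : realType} n (E : {vspace 'rV[R]_n}) : 'M[R]_(\dim E, n) :=
  get (@is_orthonormal_basis R n E).

(* orthogonal projector x |-> x *m orthoproj E (row-vector convention) *)
Definition orthoproj {R : realType} n (E : {vspace 'rV[R]_n}) : 'M[R]_n :=
  (onb E)^T *m onb E.

(* The (\dim E)-dimensional Lebesgue measure on E, seen as a measure on R^n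
   carried by E: image of Lebesgue measure on R^(\dim E) under the linear
   isometry onto E given by an orthonormal basis. *)
Section lebesgue_on.
Local Open Scope ereal_scope.
Context {R : realType} (n : nat) (E : {vspace 'rV[R]_n}).

Definition lebesgue_on : set 'rV[R]_n -> \bar R :=
  pushforward (lebesgue_rV R (\dim E)) (fun u => u *m onb E).

Let mE := measurable_mulmx_rV (onb E).

Let lebesgue_on0 : lebesgue_on set0 = 0.
Proof. by rewrite /lebesgue_on /pushforward preimage_set0 measure0. Qed.

Let lebesgue_on_ge0 A : 0 <= lebesgue_on A.
Proof. by rewrite /lebesgue_on /pushforward measure_ge0. Qed.

Let lebesgue_on_sigma_additive : semi_sigma_additive lebesgue_on.
Proof. exact: (@measure_semi_sigma_additive _ _ _ (pushforward _ _)). Qed.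

HB.instance Definition _ := isMeasure.Build _ _ _ lebesgue_on
  lebesgue_on0 lebesgue_on_ge0 lebesgue_on_sigma_additive.

End lebesgue_on.

Definition proj_fun {R : realType} n (E : {vspace 'rV[R]_n})
    (f : 'rV[R]_n -> R) (x : 'rV[R]_n) : \bar R :=
  ereal_sup [set (f (x + y))%:E | y in orthocomp E].

Definition proj_norm1 {R : realType} n (E : {vspace 'rV[R]_n})
    (f : 'rV[R]_n -> R) : \bar R :=
  (\int[lebesgue_on E]_(x in [set x | x \in E]) `|proj_fun E f x|)%E.

Definition hyperplane (R : realType) n : Type :=
  {E : {vspace 'rV[R]_n} | \dim E == n.-1}.

Definition hyperplane_display : measure_display -> measure_display.
Proof. exact. Qed.

(* The Borel sigma-algebra of the Grassmann manifold G_{n,n-1}, whose topology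
   (that of the metric |P_E - P_F|) is induced by the embedding sending E to
   its orthogonal projector. *)
Section measurable_hyperplane.
Context {R : realType} (n : nat).

Let hyperplane0 : hyperplane R n.
Proof.
exists <<take n.-1 (vbasis (fullv : {vspace 'rV[R]_n}))>>%VS.
have fb : free (vbasis (fullv : {vspace 'rV[R]_n})).
  exact: basis_free (vbasisP _).
rewrite -(cat_take_drop n.-1 (vbasis _)) in fb.
rewrite (eqP (catl_free fb)) size_take size_tuple dimvf /dim/= mul1n.
by case: n => //= m; rewrite ltnSn.
Qed.

HB.instance Definition _ := Choice.on (hyperplane R n).
HB.instance Definition _ := isPointed.Build (hyperplane R n) hyperplane0.

Let vproj (E : hyperplane R n) : 'rV[R]_(n * n) := mxvec (orthoproj (val E)).

Let hyperplane_sets : set (set (hyperplane R n)) :=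
  preimage_set_system setT vproj measurable.

Let hyperplane_sigma : sigma_algebra setT hyperplane_sets.
Proof. exact/sigma_algebra_preimage/sigma_algebra_measurable. Qed.

Let hyperplane_set0 : hyperplane_sets set0.
Proof. by case: hyperplane_sigma. Qed.

Let hyperplane_setC A : hyperplane_sets A -> hyperplane_sets (~` A).
Proof. by case: hyperplane_sigma => _ + _ => /[apply]; rewrite setTD. Qed.

Let hyperplane_bigcup (F : _^nat) : (forall i, hyperplane_sets (F i)) ->
  hyperplane_sets (\bigcup_i (F i)).
Proof. by case: hyperplane_sigma => _ _; exact. Qed.

HB.instance Definition _ := @isMeasurable.Build
  (hyperplane_display (rV_display R.-ocitv.-measurable.-sigma))
  (hyperplane R n) hyperplane_sets
  hyperplane_set0 hyperplane_setC hyperplane_bigcup.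

End measurable_hyperplane.

Definition is_rotation {R : realType} n (U : 'M[R]_n) : Prop :=
  U *m U^T = 1%:M /\ \det U = 1.

Definition rotation_invariant {R : realType} n
    (nu : set (hyperplane R n) -> \bar R) : Prop :=
  forall (U : 'M[R]_n) (A : set (hyperplane R n)),
    is_rotation U -> measurable A ->
    nu [set F | exists2 E, A E & val F = (linfun (mulmxr U) @: val E)%VS]
      = nu A.

(* only meant for psi > -oo; at t = 0, 1 the convention 0 * +oo = 0 applies *)
Definition convex_efun {R : realType} n (psi : 'rV[R]_n -> \bar R) : Prop :=
  forall (x y : 'rV[R]_n) (t : R), 0 <= t <= 1 ->
    (psi (t *: x + (1 - t) *: y)%R
       <= t%:E * psi x + (1 - t)%:E * psi y)%E.

Definition log_concave {R : realType} n (f : 'rV[R]_n -> R) : Prop :=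
  exists psi : 'rV[R]_n -> \bar R,
    [/\ forall x, (-oo < psi x)%E, convex_efun psi &
        forall x, (f x)%:E = expeR (- psi x)%E].

(* A log-concave function is always Lebesgue measurable but need not be Borel
   (its values on the boundary of its level sets are not controlled). *)
Definition lebesgue_measurable {R : realType} n (f : 'rV[R]_n -> R) : Prop :=
  exists2 g : 'rV[R]_n -> R, measurable_fun [set: 'rV[R]_n] g &
    {ae lebesgue_rV R n, forall x, f x = g x}.

Definition has_density {R : realType} n (mu : set 'rV[R]_n -> \bar R)
    (f : 'rV[R]_n -> R) : Prop :=
  lebesgue_measurable f /\
  forall A, measurable A -> mu A = (\int[lebesgue_rV R n]_(x in A) (f x)%:E)%E.

Definition isotropic {R : realType} n (f : 'rV[R]_n -> R) : Prop :=
  (forall i : 'I_n, (\int[lebesgue_rV R n]_x (x ord0 i * f x)%:E = 0)%E) /\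
  (forall i j : 'I_n,
    (\int[lebesgue_rV R n]_x (x ord0 i * x ord0 j * f x)%:E
       = (i == j)%:R%:E)%E).

(* Main.v *)
Require Import Defs.
From HB Require Import structures.
From mathcomp Require Import finmap.
From mathcomp Require Import all_boot all_order all_algebra all_fingroup.
From mathcomp Require Import all_classical all_reals all_analysis.
From mathcomp Require Import measurable_realfun ess_sup_inf ring lra.

(** The bound holds for averages over finite families of hyperplanes, and is then
    integrated over the Grassmannian.

    Thickening by segments.  Let E be a hyperplane with unit normal th.  Replacing
    a function by its supremum over the translates by [- d, d] th increases its
    integral by at least 2 d times the integral over E of its suprema along the
    lines directed by th: on each line, the graph is cut at an almost maximal
    point and a plateau of length 2 d is inserted
    ([sup_translates_segment]).  Adding successively the segments of N hyperplanes
    E_1, ..., E_N gives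
      2 d (|P_E_1 f|_1 + ... + |P_E_N f|_1) <= integral of sup_(z in Z) f (x + z)
    where Z is the sum of the N segments ([sum_proj_norm1_le]).  If the normals
    form a tight frame, Z has radius at most d N / sqrt n.  For an arbitrary unit
    vector th, the vectors th U, with U ranging over the rotations of the cube, do
    form a tight frame ([signed_rotations_frame]).  So d can be taken of order
    1 / (N sqrt n) while Z stays in a ball of radius of order 1 / n.

    Small translations cost a constant factor.  There is an absolute constant
    decay such that decay f (x + z) <= f ((1 - 1/n) x) as soon as |z| is at most
    1 / (56 n) ([isotropic_dilation]), so the integral of the supremum is at most
    decay^-1 (1 - 1/n)^-n <= decay^-1 expR 2.  By log-concavity this follows from
    f >= decay^n f 0 on the ball of radius 1/56 ([isotropic_inner_ball]).  If that
    failed at a point w, a hyperplane would separate w from the convex set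
    where f >= decay^n f 0 ([convex_separation]), and beyond this hyperplane
    log-concavity towards the origin, where f is maximal, would give
    f x <= decay f ((1 - 1/n) x).  Little mass would then lie beyond a hyperplane
    at distance at most 1/56 from the barycentre, so the mean of |<x, u>| would be
    small for its normal u ([isotropic_deep_halfspace]).  But <x, u> has
    variance one, and the Prekopa-Leindler inequality ([prekopa_leindler]) shows
    that its mean absolute value then exceeds 1/7.

    Consequently the sum of |P_(E U) f|_1 over the N rotations U of the cube is at
    most N C sqrt n for every hyperplane E ([sum_proj_norm1_frame]).  Integrating
    in E and using rotation invariance gives the theorem
    ([integral_le_rotations]).

    The density is Lebesgue measurable only, and neither the measurability of its
    projections nor that of E |-> |P_E f|_1 is established.  Three devices deal
    with this: f is enclosed between two Borel functions equal to it almost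
    everywhere, suprema over translates are taken over open neighbourhoods, which
    makes them Borel, and monotonicity of the integral is used for nonmeasurable
    nonnegative functions. *)

Set Implicit Arguments.
Unset Strict Implicit.
Unset Printing Implicit Defensive.

Import Order.TTheory GRing.Theory Num.Theory.
Import numFieldNormedType.Exports.

Local Open Scope classical_set_scope.
Local Open Scope ring_scope.

(** * Lebesgue measure on row vectors *)

Section lower_integral.
Local Open Scope ereal_scope.
Context d (T : measurableType d) (R : realType).
Variable mu : {measure set T -> \bar R}.

(** The integral of a nonnegative function is a supremum over the simple
    functions below it, so it is monotone with no measurability assumption.
    This matters because the density and its projections need not be Borel. *)
Lemma le_integralT (f g : T -> \bar R) :
  (forall x, 0 <= f x) -> (forall x, f x <= g x) ->
  \int[mu]_x f x <= \int[mu]_x g x.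
Proof.
move=> f0 fg; have g0 x : 0 <= g x by exact: le_trans (fg x).
rewrite !ge0_integralTE//; apply: le_ereal_sup => _ [h /= hf <-].
by exists h => //= x; exact: le_trans (fg x).
Qed.

End lower_integral.

Section lebesgue_rV_theory.
Local Open Scope ereal_scope.
Context {R : realType}.
Local Notation leb := (@lebesgue_measure R).

Lemma ge0_integral_translation (g : R -> \bar R) (c : R) :
  measurable_fun setT g -> (forall x, 0 <= g x) ->
  \int[leb]_x g (x + c)%R = \int[leb]_x g x.
Proof.
move=> mg g0.
have mc : measurable_fun [set: R] (fun x : R => x + c)%R.
  exact: measurable_funD.
rewrite -[RHS](_ : \int[pushforward leb
    ((fun x => x + c)%R : _ -> measurableTypeR R)]_x g x = _).
  by rewrite ge0_integral_pushforward.
apply: eq_measure_integral => A mA _; apply/esym.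
apply: lebesgue_measure_unique => //= _ [[a b]] _ <-.
rewrite /pushforward.
rewrite [X in _ = leb X](_ : _ = `](a - c)%R, (b - c)%R]%classic); last first.
  by apply/seteqP; split => x /=; rewrite !in_itv/= ltrBlDr lerBrDr.
rewrite !lebesgue_measure_itv/= !lte_fin ltrD2r.
by case: ifPn => // _; rewrite -!EFinB; congr (_%:E); lra.
Qed.

Lemma measurable_funD_rV d (T : measurableType d) n (f g : T -> 'rV[R]_n) :
  measurable_fun setT f -> measurable_fun setT g ->
  measurable_fun setT (fun t => f t + g t)%R.
Proof.
move=> /measurable_fun_rVP mf /measurable_fun_rVP mg.
apply/measurable_fun_rVP => i; under eq_fun do rewrite mxE.
exact: measurable_funD.
Qed.

Lemma measurable_funZ_rV d (T : measurableType d) n (c : T -> R)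
    (f : T -> 'rV[R]_n) :
  measurable_fun setT c -> measurable_fun setT f ->
  measurable_fun setT (fun t => c t *: f t)%R.
Proof.
move=> mc /measurable_fun_rVP mf.
apply/measurable_fun_rVP => i; under eq_fun do rewrite mxE.
exact: measurable_funM.
Qed.

Lemma measurable_funN_rV d (T : measurableType d) n (f : T -> 'rV[R]_n) :
  measurable_fun setT f -> measurable_fun setT (fun t => - f t)%R.
Proof.
move=> /measurable_fun_rVP mf.
apply/measurable_fun_rVP => i; under eq_fun do rewrite mxE.
by apply: measurableT_comp (mf i).
Qed.

Lemma measurable_funM_rV d (T : measurableType d) n p (f : T -> 'rV[R]_n)
    (A : 'M[R]_(n, p)) :
  measurable_fun setT f -> measurable_fun setT (fun t => f t *m A).
Proof. by move=> mf; exact: measurableT_comp (measurable_mulmx_rV A) mf. Qed.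

Lemma ge0_integral_rV_cons n (g : 'rV[R]_(1 + n) -> \bar R) :
  measurable_fun setT g -> (forall x, 0 <= g x) ->
  \int[lebesgue_rV R (1 + n)]_x g x =
  \int[leb]_s \int[lebesgue_rV R n]_v g (rV_cons (s, v)).
Proof.
move=> mg g0; rewrite [LHS]ge0_integral_pushforward//=; last first.
  exact: measurable_rV_cons.
rewrite preimage_setT fubini_tonelli1//.
exact: measurableT_comp mg (@measurable_rV_cons R n).
Qed.

Lemma ge0_integral_rV_cons_swap n (g : 'rV[R]_(1 + n) -> \bar R) :
  measurable_fun setT g -> (forall x, 0 <= g x) ->
  \int[lebesgue_rV R (1 + n)]_x g x =
  \int[lebesgue_rV R n]_v \int[leb]_s g (rV_cons (s, v)).
Proof.
move=> mg g0; rewrite [LHS]ge0_integral_pushforward//=; last first.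
  exact: measurable_rV_cons.
rewrite preimage_setT fubini_tonelli2//.
exact: measurableT_comp mg (@measurable_rV_cons R n).
Qed.

Lemma rV_consD n (s t : R) (u v : 'rV[R]_n) :
  (rV_cons (s, u) + rV_cons (t, v) = rV_cons (s + t, u + v))%R.
Proof.
rewrite /rV_cons add_row_mx; congr (row_mx _ _).
by apply/matrixP => i j; rewrite !mxE.
Qed.

Lemma rV_unconsK n (x : 'rV[R]_(1 + n)) : rV_cons (rV_uncons x) = x.
Proof.
rewrite /rV_cons /rV_uncons/= -[RHS](hsubmxK x); congr (row_mx _ _).
by apply/matrixP => i j; rewrite !mxE !ord1.
Qed.

Lemma measurable_rV_cons_r n (s : R) :
  measurable_fun setT (fun v : 'rV[R]_n => rV_cons (s, v)).
Proof.
apply: (@measurableT_comp _ _ _ _ _ _ (@rV_cons R n)) => //.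
exact: measurable_rV_cons.
Qed.

Lemma ge0_integral_rV_translation n (g : 'rV[R]_n -> \bar R) (c : 'rV[R]_n) :
  measurable_fun setT g -> (forall x, 0 <= g x) ->
  \int[lebesgue_rV R n]_x g (x + c)%R = \int[lebesgue_rV R n]_x g x.
Proof.
elim: n g c => [|n IH] g c mg g0.
  by apply: eq_integral => x _; congr g; apply/matrixP => i [].
rewrite ge0_integral_rV_cons//=; last first.
  by apply: measurableT_comp mg _; apply: measurable_funD_rV.
rewrite [RHS]ge0_integral_rV_cons//=.
have [c0 [c1 ->]] : exists c0 c1, c = rV_cons (c0, c1).
  by exists (rV_uncons c).1, (rV_uncons c).2; rewrite -surjective_pairing rV_unconsK.
rewrite -[RHS](ge0_integral_translation c0); first last.
- by move=> s; exact: integral_ge0.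
- apply: (measurable_fun_fubini_tonelli_F (fun p => g (rV_cons p))) => //.
  exact: measurableT_comp mg (@measurable_rV_cons R n).
apply: eq_integral => s _; rewrite -[RHS](IH _ c1)//.
- by apply: eq_integral => v _; rewrite rV_consD.
- exact: measurableT_comp mg (measurable_rV_cons_r _).
Qed.

Lemma rV_cons_head n (s : R) (v : 'rV[R]_n) :
  rV_cons (s, v) ord0 (lshift n ord0) = s.
Proof. by rewrite /rV_cons row_mxEl mxE. Qed.

Lemma rV_cons_tail n (s : R) (v : 'rV[R]_n) i :
  rV_cons (s, v) ord0 (rshift 1 i) = v ord0 i.
Proof. by rewrite /rV_cons row_mxEr. Qed.

Definition rV_box n (a : R) : set 'rV[R]_n :=
  [set x | forall i, (`|x ord0 i| < a)%R].

Lemma measurable_rV_box n a : measurable (@rV_box n a).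
Proof.
rewrite (_ : rV_box a = \bigcap_(i in [set: 'I_n])
    ((fun x : 'rV[R]_n => x ord0 i) @^-1` `](- a)%R, a[)).
  apply: fin_bigcap_measurable => // i _.
  by rewrite -[X in measurable X]setTI; exact: measurable_rV_coord.
apply/seteqP; split=> x /= bx i; first by move=> _ /=; rewrite in_itv/= -ltr_norml.
by have := bx i I; rewrite /= in_itv/= -ltr_norml.
Qed.

Lemma lebesgue_rV_box n (a : R) : (0 <= a)%R ->
  lebesgue_rV R n (@rV_box n a) = ((2 * a) ^+ n)%:E.
Proof.
move=> a0; elim: n => [|n IH].
  rewrite /= diracE mem_set ?expr0//; by move=> [].
rewrite /= /lebesgue_rV_step /pushforward.
rewrite (_ : _ @^-1` _ = `](- a)%R, a[ `*` @rV_box n a).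
  rewrite product_measure1E//=; last exact: measurable_rV_box.
  rewrite IH lebesgue_measure_itv/= lte_fin.
  case: ltP => [_|aN]; first by rewrite -EFinB -EFinM exprS; congr (_ * _)%:E; lra.
  have -> : a = 0%R by lra.
  by rewrite mul0e mulr0 expr0n.
apply/seteqP; split=> [[s v]|[s v]]/= bx.
  split=> [|i]; last by rewrite -(rV_cons_tail s v i); exact: bx.
  by rewrite in_itv/= -ltr_norml -(rV_cons_head s v); exact: bx.
case: bx => /=; rewrite in_itv/= -ltr_norml => sa va i.
by have [j ->|j ->] := @split_ordP 1 n i; rewrite ?ord1 ?rV_cons_head ?rV_cons_tail.
Qed.

(** The double integral of g (x T + y) 1_B(y) is computed in two orders;
    translation invariance evaluates both inner integrals.  The Jacobian of T
    thus appears as the ratio of the measures of two explicit sets, which a box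
    settles for homotheties and a ball for isometries. *)
Lemma ge0_integral_linear_change n (T : 'M[R]_n) (B : set 'rV[R]_n)
    (g : 'rV[R]_n -> \bar R) : T \in unitmx -> measurable B ->
  measurable_fun setT g -> (forall x, 0 <= g x) ->
  \int[lebesgue_rV R n]_x g (x *m T) * lebesgue_rV R n B =
  \int[lebesgue_rV R n]_x g x * lebesgue_rV R n [set x | B (- (x *m T))%R].
Proof.
move=> uT mB mg g0; set lam := lebesgue_rV R n.
have mT := measurable_mulmx_rV T.
have iB0 x : 0 <= (\1_B x)%:E :> \bar R by rewrite lee_fin.
have miB : measurable_fun setT (fun y => (\1_B y)%:E : \bar R).
  exact/measurable_EFinP/measurable_indic.
have mgT : measurable_fun setT (fun x => g (x *m T)) by exact: measurableT_comp mg mT.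
have mB' : measurable [set x | B (- (x *m T))%R].
  rewrite -[X in measurable X]setTI.
  exact: (measurable_funN_rV mT).
have mF1 : measurable_fun setT
    (fun p : 'rV[R]_n * 'rV[R]_n => g (p.1 *m T + p.2)%R * (\1_B p.2)%:E).
  apply: emeasurable_funM; last exact: measurableT_comp miB measurable_snd.
  apply: measurableT_comp mg _; apply: measurable_funD_rV => //.
  by apply: measurable_funM_rV.
have mF2 : measurable_fun setT
    (fun p : 'rV[R]_n * 'rV[R]_n => g p.2 * (\1_B (p.2 - p.1 *m T)%R)%:E).
  apply: emeasurable_funM; first exact: measurableT_comp mg measurable_snd.
  apply: measurableT_comp miB _; apply: measurable_funD_rV => //.
  by apply: measurable_funN_rV; apply: measurable_funM_rV.
transitivity (\int[lam]_y \int[lam]_x (g (x *m T + y)%R * (\1_B y)%:E)).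
  rewrite (_ : lam B = \int[lam]_x (\1_B x)%:E); last first.
    by rewrite integral_indic// setIT.
  rewrite -ge0_integralZl//; last by apply: integral_ge0.
  apply: eq_integral => y _; rewrite -ge0_integralZr//.
  rewrite -[LHS](ge0_integral_rV_translation (y *m invmx T))//; first last.
  - by move=> x; rewrite mule_ge0.
  - exact: emeasurable_funM.
  by apply: eq_integral => x _; rewrite mulmxDl mulmxKV.
rewrite -(fubini_tonelli (fun p => g (p.1 *m T + p.2)%R * (\1_B p.2)%:E))//=; last first.
  by move=> p; rewrite mule_ge0.
transitivity (\int[lam]_x \int[lam]_y (g y * (\1_B (y - x *m T)%R)%:E)).
  apply: eq_integral => x _.
  rewrite -[RHS](ge0_integral_rV_translation (x *m T))//; first last.
  - by move=> y; rewrite mule_ge0.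
  - exact: (measurableT_comp mF2 (pair1_measurable x)).
  by apply: eq_integral => y _; rewrite addrK addrC.
rewrite (fubini_tonelli (fun p => g p.2 * (\1_B (p.2 - p.1 *m T)%R)%:E))//=; last first.
  by move=> p; rewrite mule_ge0.
rewrite (_ : lam [set x | B _] =
    \int[lam]_x (\1_[set x | B (- (x *m T))%R] x)%:E); last first.
  by rewrite integral_indic// setIT.
rewrite -ge0_integralZr//; last first.
  by apply: integral_ge0 => x _; rewrite lee_fin.
apply: eq_integral => y _; rewrite -ge0_integralZl//; last exact/measurable_EFinP/measurable_indic.
rewrite -[LHS](ge0_integral_rV_translation (y *m invmx T))//; first last.
- by move=> x; rewrite mule_ge0.
- exact: (measurableT_comp mF2 (pair2_measurable y)).
apply: eq_integral => x _; rewrite mulmxDl mulmxKV// opprD addrCA subrr addr0.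
by congr (_ * _%:E).
Qed.

End lebesgue_rV_theory.

(** * Scalar product and change of variables *)

Section dotp_theory.
Context {R : realType}.
Implicit Types (n : nat) (a : R).

Lemma dotpE n (x y : 'rV[R]_n) : dotp x y = \sum_i x ord0 i * y ord0 i.
Proof. by rewrite /dotp !mxE; apply: eq_bigr => i _; rewrite !mxE. Qed.

Lemma dotpC n (x y : 'rV[R]_n) : dotp x y = dotp y x.
Proof. by rewrite !dotpE; apply: eq_bigr => i _; rewrite mulrC. Qed.

Lemma dotpDl n (x y z : 'rV[R]_n) : dotp (x + y) z = dotp x z + dotp y z.
Proof. by rewrite /dotp mulmxDl mxE. Qed.

Lemma dotpZl n a (x z : 'rV[R]_n) : dotp (a *: x) z = a * dotp x z.
Proof. by rewrite /dotp -scalemxAl mxE. Qed.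

Lemma dotpNl n (x z : 'rV[R]_n) : dotp (- x) z = - dotp x z.
Proof. by rewrite /dotp mulNmx mxE. Qed.

Lemma dotp0l n (z : 'rV[R]_n) : dotp 0 z = 0.
Proof. by rewrite /dotp mul0mx mxE. Qed.

Lemma dotpDr n (x y z : 'rV[R]_n) : dotp z (x + y) = dotp z x + dotp z y.
Proof. by rewrite dotpC dotpDl !(dotpC z). Qed.

Lemma dotpZr n a (x z : 'rV[R]_n) : dotp z (a *: x) = a * dotp z x.
Proof. by rewrite dotpC dotpZl dotpC. Qed.

Lemma dotpNr n (x z : 'rV[R]_n) : dotp z (- x) = - dotp z x.
Proof. by rewrite dotpC dotpNl dotpC. Qed.

Lemma dotp0r n (z : 'rV[R]_n) : dotp z 0 = 0.
Proof. by rewrite dotpC dotp0l. Qed.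

Lemma dotp_mulmx n m (x : 'rV[R]_n) (A : 'M[R]_(n, m)) (y : 'rV[R]_m) :
  dotp (x *m A) y = dotp x (y *m A^T).
Proof. by rewrite /dotp trmx_mul trmxK mulmxA. Qed.

Lemma dotp_ge0 n (x : 'rV[R]_n) : 0 <= dotp x x.
Proof. by rewrite dotpE sumr_ge0// => i _; rewrite -expr2 sqr_ge0. Qed.

Lemma dotp_eq0 n (x : 'rV[R]_n) : (dotp x x == 0) = (x == 0).
Proof.
apply/eqP/eqP => [|->]; last by rewrite dotp0l.
rewrite dotpE => /eqP; rewrite psumr_eq0; last first.
  by move=> i _; rewrite -expr2 sqr_ge0.
move=> /allP x0; apply/rowP => i; rewrite !mxE.
by have := x0 i (mem_index_enum i); rewrite /= -expr2 sqrf_eq0 => /eqP.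
Qed.

Lemma dotp_gt0 n (x : 'rV[R]_n) : (0 < dotp x x) = (x != 0).
Proof. by rewrite lt_def dotp_ge0 andbT dotp_eq0. Qed.

Lemma dotp_CauchySchwarz n (x y : 'rV[R]_n) :
  dotp x y ^+ 2 <= dotp x x * dotp y y.
Proof.
have [->|y0] := eqVneq y 0; first by rewrite !dotp0r mulr0 expr0n.
have yy : 0 < dotp y y by rewrite dotp_gt0.
have := dotp_ge0 (dotp y y *: x - dotp x y *: y).
rewrite dotpDl !dotpDr !dotpNl !dotpNr !dotpZl !dotpZr (dotpC y x) => h.
have : 0 <= dotp y y * (dotp x x * dotp y y - dotp x y ^+ 2).
  by apply: (le_trans h); rewrite le_eqVlt; apply/orP; left; apply/eqP; ring.
by rewrite pmulr_rge0// subr_ge0.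
Qed.

Lemma dotpD_le n (x y : 'rV[R]_n) :
  dotp (x + y) (x + y) <= 2 * dotp x x + 2 * dotp y y.
Proof.
have := dotp_ge0 (x - y); rewrite !dotpDl !dotpDr !dotpNl !dotpNr (dotpC y x).
by move=> h; lra.
Qed.

Lemma normalize_dotp n (v : 'rV[R]_n) : v != 0 ->
  dotp ((Num.sqrt (dotp v v))^-1 *: v) ((Num.sqrt (dotp v v))^-1 *: v) = 1.
Proof.
move=> v0; rewrite dotpZl dotpZr mulrA -invfM -expr2 sqr_sqrtr ?dotp_ge0//.
by rewrite mulVf// dotp_eq0.
Qed.

Lemma col_mx_orthonormal (k n : nat) (th : 'rV[R]_n) (B : 'M[R]_(k, n)) :
  dotp th th = 1 -> B *m B^T = 1%:M -> th *m B^T = 0 ->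
  (col_mx th B : 'M[R]_(1 + k, n)) *m (col_mx th B)^T = 1%:M.
Proof.
move=> t1 BB tB; rewrite tr_col_mx mul_col_row BB tB.
have -> : th *m th^T = 1%:M.
  by apply/matrixP => i j; rewrite !ord1 -[LHS]/(dotp th th) t1 mxE eqxx.
have -> : B *m th^T = 0 by rewrite -[LHS]trmxK trmx_mul trmxK tB trmx0.
by rewrite -scalar_mx_block.
Qed.

Lemma measurable_dotpl n (u : 'rV[R]_n) :
  measurable_fun setT (fun x : 'rV[R]_n => dotp x u).
Proof.
under eq_fun do rewrite dotpE.
apply: measurable_sum => i.
by apply: measurable_funM => //; exact: measurable_rV_coord.
Qed.

Lemma measurable_dotpxx n :
  measurable_fun setT (fun x : 'rV[R]_n => dotp x x).
Proof.
under eq_fun do rewrite dotpE.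
apply: measurable_sum => i.
by apply: measurable_funM => //; exact: measurable_rV_coord.
Qed.

End dotp_theory.

Section change_of_variables.
Local Open Scope ereal_scope.
Context {R : realType}.

Lemma mule_cancelr (z x y : \bar R) : 0 < z -> z < +oo -> x * z = y * z -> x = y.
Proof.
move=> z0 zoo h; have zf : z \is a fin_num by rewrite ge0_fin_numE// ltW.
by apply/eqP; rewrite eq_le -(lee_pmul2r zf z0 x y)/= h lexx/=
  -(lee_pmul2r zf z0 y x)/= h lexx.
Qed.

Lemma ge0_integral_scale n (c : R) (g : 'rV[R]_n -> \bar R) : (0 < c)%R ->
  measurable_fun setT g -> (forall x, 0 <= g x) ->
  \int[lebesgue_rV R n]_x g (c *: x)%R =
  ((c ^+ n)^-1)%:E * \int[lebesgue_rV R n]_x g x.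
Proof.
move=> c0 mg g0.
have uc : (c%:M : 'M[R]_n) \in unitmx.
  by rewrite unitmxE det_scalar unitrX// unitfE gt_eqF.
have := ge0_integral_linear_change uc (@measurable_rV_box R n 1) mg g0.
under eq_integral do rewrite mul_mx_scalar.
rewrite (_ : [set x | _] = rV_box (c^-1)); last first.
  apply/seteqP; split=> x /= xb i; have := xb i; rewrite mul_mx_scalar !mxE;
  by rewrite normrN normrM gtr0_norm// -[(c^-1)%R]mul1r ltr_pdivlMr// mulrC.
rewrite !lebesgue_rV_box ?invr_ge0 ?ltW// mulr1 => h.
have p2 : (0 < 2 ^+ n :> R)%R by rewrite exprn_gt0.
apply: (@mule_cancelr (2 ^+ n)%:E); [by rewrite lte_fin|exact: ltry|].
rewrite h exprMn EFinM exprVn muleCA muleC; congr (_ * _).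
by rewrite muleC.
Qed.

Definition rV_ball n : set 'rV[R]_n := [set x | (dotp x x < 1)%R].
Arguments rV_ball n : clear implicits.

Lemma measurable_rV_ball n : measurable (rV_ball n).
Proof.
rewrite (_ : rV_ball n = setT `&` (fun x => dotp x x) @^-1` `]-oo, 1%R[).
  exact: measurable_dotpxx.
by rewrite setTI; apply/seteqP; split => x /=; rewrite in_itv.
Qed.

Lemma lebesgue_rV_ball_fin n : lebesgue_rV R n (rV_ball n) < +oo.
Proof.
apply: (@le_lt_trans _ _ (lebesgue_rV R n (rV_box 1))); last first.
  by rewrite lebesgue_rV_box ?ltry.
apply: le_measure; rewrite ?inE; [exact: measurable_rV_ball|
  exact: measurable_rV_box|].
move=> x /= x1 i; rewrite -(@ltr_pXn2r _ 2)// ?nnegrE// expr1n real_normK ?num_real//.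
apply: le_lt_trans x1; rewrite dotpE (bigD1 i)//= -expr2 lerDl sumr_ge0// => j _.
by rewrite -expr2 sqr_ge0.
Qed.

Lemma lebesgue_rV_ball_gt0 n : 0 < lebesgue_rV R n (rV_ball n).
Proof.
pose a : R := ((n.+1%:R)^-1)%R.
have a0 : (0 < a)%R by rewrite invr_gt0.
apply: (@lt_le_trans _ _ (lebesgue_rV R n (rV_box a))).
  by rewrite lebesgue_rV_box ?ltW// lte_fin exprn_gt0// mulr_gt0.
apply: le_measure; rewrite ?inE; [exact: measurable_rV_box|
  exact: measurable_rV_ball|].
move=> x /= xb; rewrite /rV_ball/= dotpE.
apply: (@le_lt_trans _ _ (\sum_(i < n) a)%R).
  apply: ler_sum => i _; rewrite -expr2 -real_normK ?num_real//.
  have xa := ltW (xb i); apply: (@le_trans _ _ (a ^+ 2)%R).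
    by rewrite lerXn2r// nnegrE// ltW.
  rewrite expr2; apply: ler_piMr; first exact: ltW.
  by rewrite /a invf_le1// ler1n.
rewrite sumr_const card_ord -[(_ *+ _)%R]mulr_natr mulrC /a ltr_pdivrMr//.
by rewrite mul1r ltr_nat.
Qed.

(** The unit ball, a test set of positive finite measure, is preserved by
    x |-> - x O, so the Jacobian is one. *)
Lemma ge0_integral_orthogonal n (O : 'M[R]_n) (g : 'rV[R]_n -> \bar R) :
  O *m O^T = 1%:M -> measurable_fun setT g -> (forall x, 0 <= g x) ->
  \int[lebesgue_rV R n]_x g (x *m O) = \int[lebesgue_rV R n]_x g x.
Proof.
move=> OO mg g0.
have uO : O \in unitmx by case/mulmx1_unit : OO.
have := ge0_integral_linear_change uO (@measurable_rV_ball n) mg g0.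
rewrite (_ : [set x | _] = rV_ball n); last first.
  apply/seteqP; split=> x /=; rewrite /rV_ball/= dotpNl dotpNr opprK;
  by rewrite dotp_mulmx -mulmxA OO mulmx1.
by apply: mule_cancelr; [exact: lebesgue_rV_ball_gt0|exact: lebesgue_rV_ball_fin].
Qed.

End change_of_variables.

(** * The Prekopa-Leindler inequality *)

Section prekopa_leindler.
Local Open Scope ereal_scope.
Context {R : realType}.
Local Notation leb := (@lebesgue_measure R).

Lemma mule_ereal_sup_le (S : set (\bar R)) (x c : \bar R) :
  (forall s, S s -> 0 <= s) -> 0 <= x -> 0 <= c ->
  (forall s, S s -> s * x <= c) -> 0 <= ereal_sup S -> ereal_sup S * x <= c.
Proof.
move=> S0 x0 c0 Sx supS0.
have [->|cNoo] := eqVneq c +oo; first exact: leey.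
have [->|xN0] := eqVneq x 0; first by rewrite mule0.
have [|xNoo] := eqVneq x +oo => [xoo|].
  suff -> : ereal_sup S = 0 by rewrite mul0e.
  apply/eqP; rewrite eq_le supS0 andbT; apply: ge_ereal_sup => s Ss.
  rewrite leNgt; apply/negP => s_gt0; have := Sx _ Ss.
  by rewrite xoo gt0_muley// leye_eq (negbTE cNoo).
case: x x0 xN0 xNoo Sx => // r r0 rN0 _ Sx.
have {}r0 : (0 < r)%R by rewrite lt_def -(inj_eq (@EFin_inj R)) rN0 -lee_fin.
rewrite -lee_pdivlMr//; apply: ge_ereal_sup => s Ss.
by rewrite lee_pdivlMr//; exact: Sx.
Qed.

Lemma measure_translation (A : set R) (c : R) : measurable A ->
  leb [set x | A (x + c)%R] = leb A.
Proof.
move=> mA.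
have mA' : measurable [set x | A (x + c)%R].
  by rewrite -[X in measurable X]setTI; apply: measurable_funD.
have E S : measurable S -> leb S = \int[leb]_x (\1_S x)%:E.
  by move=> mS; rewrite integral_indic// setIT.
rewrite (E _ mA) (E _ mA').
apply: (ge0_integral_translation c (g := fun x => (\1_A x)%:E)).
- exact/measurable_EFinP/measurable_indic.
- by move=> x; rewrite lee_fin.
Qed.

(** With a the largest point of K and b the smallest point of L, the sets
    K + b and a + L lie on the two sides of a + b, and both are in C. *)
Let measure_addset_compact (K L C : set R) :
  compact K -> compact L -> K !=set0 -> L !=set0 -> measurable C ->
  (forall a b, K a -> L b -> C (a + b)%R) -> leb K + leb L <= leb C.
Proof.
move=> cK cL K0 L0 mC KLC.
have mK : measurable K by exact: compact_measurable.
have mL : measurable L by exact: compact_measurable.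
have cid A : {within A, continuous (@idfun R)}.
  by apply: continuous_subspaceT => x; exact: cvg_id.
have [a /set_mem Ka amax] := compact_EVT_max K0 cK (cid K).
have [b /set_mem Lb bmin] := compact_EVT_min L0 cL (cid L).
have mI : measurable (`]-oo, (a + b)%R] : set R) by exact: measurable_itv.
have mJ : measurable (`](a + b)%R, +oo[ : set R) by exact: measurable_itv.
rewrite (_ : C = (C `&` `]-oo, (a + b)%R]) `|` (C `&` `](a + b)%R, +oo[)); last first.
  rewrite -setIUr; apply/seteqP; split=> x; last by case.
  move=> Cx; split=> //=; rewrite !in_itv/= andbT.
  by case: (leP x (a + b)%R); [left|right].
rewrite measureU; [|exact: measurableI|exact: measurableI|]; last first.
  apply/seteqP; split=> x //= [[_ +] [_]]; rewrite !in_itv/= andbT => xab.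
  by rewrite ltNge xab.
apply: leeD.
  rewrite -(measure_translation (- b) mK); apply: le_measure; rewrite ?inE.
  - by rewrite -[X in measurable X]setTI; apply: measurable_funD.
  - exact: measurableI.
  - move=> x /= Kx; split; first by rewrite -(subrK b x); exact: KLC.
    by rewrite in_itv/= -lerBlDr; apply: amax; rewrite inE.
have mL' : measurable [set x | L (x - a)%R].
  by rewrite -[X in measurable X]setTI; apply: measurable_funD.
rewrite -(measure_translation (- a) mL).
set L' := [set x | L (x - a)%R].
have mL1 : measurable (L' `\ (a + b)%R) by exact: measurableD.
apply: (@le_trans _ _ (leb (L' `\ (a + b)%R))).
  rewrite -[leRHS]adde0 -(lebesgue_measure_set1 (a + b)%R).
  have U2 : leb ((L' `\ (a + b)%R) `|` [set (a + b)%R]) <=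
      leb (L' `\ (a + b)%R) + leb [set (a + b)%R].
    by apply: measureU2 => //; exact: measurable_set1.
  apply: le_trans U2; apply: le_measure; rewrite ?inE//; first exact: measurableU.
  by move=> x Lx; have [->|xab] := pselect (x = (a + b)%R); [right|left].
apply: le_measure; rewrite ?inE//; first exact: measurableI.
move=> x [Lx /= xab]; split.
  by rewrite -(subrKC a x); exact: KLC.
rewrite in_itv/= andbT lt_neqAle eq_sym; apply/andP; split; first exact/eqP.
by rewrite -lerBrDl; apply: bmin; rewrite inE.
Qed.

(** The Brunn-Minkowski inequality on the line.  Inner regularity reduces it to
    compact sets; a point of A and a point of B are added to these so that they
    are never empty.  The sum set is replaced by any measurable C containing it,
    since the sum of two Borel sets need not be Borel. *)
Lemma lebesgue_measure_addset (A B C : set R) :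
  measurable A -> measurable B -> measurable C -> A !=set0 -> B !=set0 ->
  (forall a b, A a -> B b -> C (a + b)%R) -> leb A + leb B <= leb C.
Proof.
move=> mA mB mC [a0 Aa0] [b0 Bb0] ABC.
have [->|CNoo] := eqVneq (leb C) +oo; first exact: leey.
have Cfin : leb C \is a fin_num by rewrite ge0_fin_numE// ltey.
have KL K L : compact K -> K `<=` A -> compact L -> L `<=` B ->
    leb K + leb L <= leb C.
  move=> cK KA cL LB.
  apply: (@le_trans _ _ (leb (K `|` [set a0]) + leb (L `|` [set b0]))).
    have cm (S : set R) : compact S -> measurable S by exact: compact_measurable.
    apply: leeD; apply: le_measure; rewrite ?inE; try by [exact: cm|
      apply: measurableU; [exact: cm|exact: measurable_set1]|left].
  apply: measure_addset_compact => //.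
  - by apply: compactU => //; exact: compact_set1.
  - by apply: compactU => //; exact: compact_set1.
  - by exists a0; right.
  - by exists b0; right.
  - move=> a b [Ka|->] [Lb|->]; apply: ABC => //;
      first [exact: KA|exact: LB].
have KB K : compact K -> K `<=` A -> leb K + leb B <= leb C.
  move=> cK KA.
  have Kfin : leb K \is a fin_num.
    rewrite ge0_fin_numE//; apply: le_lt_trans (_ : leb C < +oo); last by rewrite ltey.
    have := KL K set0 cK KA (@compact0 _) (@sub0set _ _).
    by rewrite measure0 adde0.
  rewrite addeC -leeBrDr// (lebesgue_regularity_inner_sup mB).
  apply: ge_ereal_sup => _ [L [cL LB] <-].
  by rewrite leeBrDr// addeC KL.
have Bfin : leb B \is a fin_num.
  rewrite ge0_fin_numE//; apply: le_lt_trans (_ : leb C < +oo); last by rewrite ltey.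
  by have := KB set0 (@compact0 _) (@sub0set _ _); rewrite measure0 add0e.
rewrite -leeBrDr// (lebesgue_regularity_inner_sup mA).
apply: ge_ereal_sup => _ [K [cK KA] <-].
by rewrite leeBrDr// KB.
Qed.

(** Levels are restricted to t > 0 so that the layer-cake integral runs over
    the whole line. *)
Let superlevel (H : R -> \bar R) (t : R) := [set x | (0 < t)%R /\ t%:E <= H x].

Let measurable_superlevel H t : measurable_fun setT H ->
  measurable (superlevel H t).
Proof.
move=> mH; have [t0|t0] := boolP (0 < t)%R; last first.
  rewrite (_ : superlevel H t = set0); first exact: measurable0.
  by apply/seteqP; split=> x // -[t1 _]; rewrite t1 in t0.
rewrite (_ : superlevel H t = setT `&` H @^-1` `[t%:E, +oo[).
  by apply: mH => //; exact: emeasurable_itv.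
by rewrite setTI; apply/seteqP; split=> x /=; rewrite in_itv/= andbT; [case|].
Qed.

Let layer_cake (H : R -> \bar R) : measurable_fun setT H ->
  (forall x, 0 <= H x) ->
  measurable_fun setT (fun t => leb (superlevel H t)) /\
  \int[leb]_x H x = \int[leb]_t leb (superlevel H t).
Proof.
move=> mH H0.
pose S := [set p : R * R | (0 < p.2)%R /\ p.2%:E <= H p.1].
have mS : measurable S.
  rewrite (_ : S = (setT `&` snd @^-1` `]0%R, +oo[) `&`
    [set p | p.2%:E <= H p.1]); last first.
    by rewrite setTI; apply/seteqP; split=> p /=; rewrite in_itv/= andbT.
  apply: measurableI; first exact: measurable_snd.
  rewrite -[X in measurable X]setTI; apply: emeasurable_fun_le => //.
  - by apply/measurable_EFinP; exact: measurable_snd.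
  - exact: measurableT_comp mH measurable_fst.
have miS : measurable_fun setT (fun p : R * R => (\1_S p)%:E : \bar R).
  exact/measurable_EFinP/measurable_indic.
have iS0 p : 0 <= (\1_S p)%:E :> \bar R by rewrite lee_fin.
have GE t : leb (superlevel H t) = \int[leb]_x (\1_S (x, t))%:E.
  rewrite -(setIT (superlevel H t)) -integral_indic//.
  exact: measurable_superlevel.
split.
  rewrite (_ : (fun t => _) = fubini_G leb (fun p => (\1_S p)%:E)).
    exact: measurable_fun_fubini_tonelli_G.
  by apply/funext => t; rewrite GE.
under [RHS]eq_integral do rewrite GE.
transitivity (\int[leb]_x \int[leb]_t (\1_S (x, t))%:E); last first.
  exact: (@fubini_tonelli _ _ (measurableTypeR R) (measurableTypeR R) R leb leb
    (fun p => (\1_S p)%:E)).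
apply: eq_integral => x _.
rewrite [RHS](_ : _ = leb [set t | (0 < t)%R /\ t%:E <= H x]); last first.
  rewrite -(setIT [set t | _]) -integral_indic//.
  by have := pair1_measurable (x : measurableTypeR R) measurableT mS; rewrite setTI.
case: (H x) (H0 x) => [r r0| _|//].
  rewrite (_ : [set t | _] = `]0%R, r]%classic); last first.
    by apply/seteqP; split => t /=; rewrite in_itv/= lee_fin => /andP.
  rewrite lebesgue_measure_itv/= lte_fin sube0.
  by case: ltP => // r0'; congr _%:E; apply/eqP; rewrite eq_le r0' -lee_fin.
rewrite (_ : [set t | _] = `]0%R, +oo[%classic).
  by rewrite lebesgue_measure_itv/= ltry.
apply/seteqP; split => t /=; rewrite in_itv/= andbT; first by case.
by rewrite leey.
Qed.

Import HBNNSimple.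

Let nnsfun_attains_max (f : {nnsfun measurableTypeR R >-> R}) : exists x, forall y, (f y <= f x)%R.
Proof.
have cid A : {within A, continuous (@idfun R)}.
  by apply: continuous_subspaceT => x; exact: cvg_id.
have [] := compact_EVT_max _ (finite_compact (fimfunP f)) (cid (range f)).
  by exists (f 0%R), 0%R.
move=> _ /set_mem [x _ <-] h; exists x => y; apply: h.
by rewrite inE; exists y.
Qed.

(** Simple functions attain their maximum, and dividing by the maximum is the
    normalisation on which the argument rests; suprema over simple functions
    then give the general case. *)
Let prekopa_leindler_nnsfun (f g : {nnsfun measurableTypeR R >-> R}) (H : R -> \bar R) :
  measurable_fun setT H -> (forall x, 0 <= H x) ->
  (forall x y, (f x * g y)%:E <= H (x + y)%R * H (x + y)%R) ->
  4%:E * (\int[leb]_x (f x)%:E * \int[leb]_x (g x)%:E) <=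
  (\int[leb]_x H x) * (\int[leb]_x H x).
Proof.
move=> mH H0 fgH.
have iH0 : 0 <= \int[leb]_x H x by exact: integral_ge0.
have i0 (h : {nnsfun measurableTypeR R >-> R}) : 0 <= \int[leb]_x (h x)%:E.
  by apply: integral_ge0 => x _; rewrite lee_fin.
have nn0 (h : {nnsfun measurableTypeR R >-> R}) x : (forall y, (h y <= h x)%R) -> h x = 0%R ->
    \int[leb]_x (h x)%:E = 0.
  move=> hx hx0; apply: integral0_eq => y _; congr _%:E; apply/eqP.
  by rewrite eq_le -{1}hx0 hx fun_ge0.
have [xa xaP] := nnsfun_attains_max f; have [xb xbP] := nnsfun_attains_max g.
have [fa0|fa0] := eqVneq (f xa) 0%R.
  by rewrite (nn0 f xa)// mul0e mule0 mule_ge0.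
have [gb0|gb0] := eqVneq (g xb) 0%R.
  by rewrite (nn0 g xb)// mule0 mule0 mule_ge0.
set a := f xa in xaP fa0; set b := g xb in xbP gb0.
have a0 : (0 < a)%R by rewrite lt_def fa0 fun_ge0.
have b0 : (0 < b)%R by rewrite lt_def gb0 fun_ge0.
pose c := Num.sqrt (a * b).
have c0 : (0 < c)%R by rewrite sqrtr_gt0 mulr_gt0.
have cc : (c ^+ 2 = a * b)%R by rewrite sqr_sqrtr// ltW// mulr_gt0.
(* after division by the maxima a and b, both superlevel sets at t <= 1 are
   nonempty, as the one-dimensional Brunn-Minkowski inequality requires, and
   those at t > 1 are empty *)
have key : a^-1%:E * \int[leb]_x (f x)%:E + b^-1%:E * \int[leb]_x (g x)%:E <=
    c^-1%:E * \int[leb]_x H x.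
  have mf : measurable_fun setT (fun x => (f x)%:E) by exact/measurable_EFinP.
  have mg : measurable_fun setT (fun x => (g x)%:E) by exact/measurable_EFinP.
  have f0 x : 0 <= (f x)%:E by rewrite lee_fin.
  have g0 x : 0 <= (g x)%:E by rewrite lee_fin.
  have inv0 r : (0 < r)%R -> 0 <= r^-1%:E :> \bar R.
    by move=> r0; rewrite lee_fin invr_ge0 ltW.
  rewrite -!ge0_integralZl ?inv0//.
  have [|x|mF ->] := @layer_cake (fun x => a^-1%:E * (f x)%:E).
  - exact: emeasurable_funM.
  - by rewrite mule_ge0 ?inv0.
  have [|x|mG ->] := @layer_cake (fun x => b^-1%:E * (g x)%:E).
  - exact: emeasurable_funM.
  - by rewrite mule_ge0 ?inv0.
  have mcH : measurable_fun setT (fun x => c^-1%:E * H x) by exact: emeasurable_funM.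
  have [x|mHH ->] := layer_cake mcH.
  - by rewrite mule_ge0 ?inv0.
  rewrite -ge0_integralD//; apply: ge0_le_integral => //.
  - by move=> t _; rewrite adde_ge0.
  - exact: emeasurable_funD.
  move=> t _; have [/andP[t0 t1]|tN] := boolP ((0 < t) && (t <= 1))%R; last first.
    have E (h : {nnsfun measurableTypeR R >-> R}) x : (0 < h x)%R -> (forall y, (h y <= h x)%R) ->
        superlevel (fun y => (h x)^-1%:E * (h y)%:E) t = set0.
      move=> hx hxP; apply/seteqP; split=> y // [t0]; rewrite -EFinM lee_fin => th.
      move: tN; rewrite t0/= => /negP; apply; apply: (le_trans th).
      by rewrite mulrC ler_pdivrMr// mul1r.
    by rewrite (E f xa)// (E g xb)// !measure0 adde0.
  apply: lebesgue_measure_addset.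
  - by apply: measurable_superlevel; exact: emeasurable_funM.
  - by apply: measurable_superlevel; exact: emeasurable_funM.
  - by apply: measurable_superlevel.
  - by exists xa; split=> //; rewrite -EFinM lee_fin mulVf.
  - by exists xb; split=> //; rewrite -EFinM lee_fin mulVf.
  move=> x y [_ xf] [_ yg]; split=> //.
  rewrite -EFinM lee_fin mulrC ler_pdivlMr// in xf.
  rewrite -EFinM lee_fin mulrC ler_pdivlMr// in yg.
  rewrite muleC lee_pdivlMr// -EFinM.
  have := fgH x y; case: (H (x + y)%R) (H0 (x + y)%R) => [r r0|_ _|//].
    rewrite -EFinM !lee_fin -expr2 => fgr.
    rewrite -(@ler_pXn2r _ 2)// ?nnegrE; last by rewrite mulr_ge0// ltW.
    apply: le_trans fgr; rewrite exprMn cc.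
    rewrite (_ : t ^+ 2 * (a * b) = (t * a) * (t * b))%R; last by ring.
    by rewrite ler_pM// mulr_ge0// ltW.
  by rewrite leey.
have [->|HNoo] := eqVneq (\int[leb]_x H x) +oo.
  by rewrite mulyy leey.
have Hfin : \int[leb]_x H x \is a fin_num by rewrite ge0_fin_numE// ltey.
case: (\int[leb]_x H x) key Hfin iH0 => // h key _ h0.
have pfin (r : R) (p : \bar R) : (0 < r)%R -> 0 <= p ->
    r^-1%:E * p <= (c^-1 * h)%:E -> p \is a fin_num.
  move=> r0 p0 ph; rewrite ge0_fin_numE//; case: p p0 ph => // [p|_].
    by rewrite ltry.
  by rewrite gt0_muley ?lte_fin ?invr_gt0// leye_eq.
have inv0 r : (0 < r)%R -> 0 <= r^-1%:E :> \bar R.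
  by move=> r0; rewrite lee_fin invr_ge0 ltW.
have f_fin : \int[leb]_x (f x)%:E \is a fin_num.
  apply: (pfin a) => //; rewrite EFinM; apply: le_trans key.
  by rewrite leeDl// mule_ge0 ?inv0.
have g_fin : \int[leb]_x (g x)%:E \is a fin_num.
  apply: (pfin b) => //; rewrite EFinM; apply: le_trans key.
  by rewrite leeDr// mule_ge0 ?inv0.
rewrite -(fineK f_fin) -(fineK g_fin) in key *.
have p0 : (0 <= fine (\int[leb]_x (f x)%:E))%R by exact: fine_ge0.
have q0 : (0 <= fine (\int[leb]_x (g x)%:E))%R by exact: fine_ge0.
move: (fine (\int[leb]_x (f x)%:E)) (fine (\int[leb]_x (g x)%:E)) key p0 q0.
move=> p q key p0 q0; move: key; rewrite -!EFinM -EFinD !lee_fin mulrC [(b^-1 * q)%R]mulrC.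
rewrite [(c^-1 * h)%R]mulrC ler_pdivlMr// => key.
have pE : p = (p / a * a)%R by rewrite divfK.
have qE : q = (q / b * b)%R by rewrite divfK.
have u0 : (0 <= p / a)%R by rewrite divr_ge0// ltW.
have v0 : (0 <= q / b)%R by rewrite divr_ge0// ltW.
rewrite {1}pE {1}qE; set u := (p / a)%R in key u0 *; set v := (q / b)%R in key v0 *.
apply: (@le_trans _ _ (((u + v) * c) * ((u + v) * c))%R); last first.
  by rewrite ler_pM// mulr_ge0// ?addr_ge0// ltW.
(* arithmetic-geometric mean inequality: 4 u v <= (u + v)^2 *)
rewrite -subr_ge0 (_ : _ - _ = a * b * (u - v) ^+ 2)%R.
  by rewrite mulr_ge0 ?sqr_ge0// mulr_ge0// ltW.
by rewrite -!expr2 exprMn cc; ring.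
Qed.

Let mule_ereal_sup2_le (S T : set (\bar R)) (c : \bar R) :
  (forall s, S s -> 0 <= s) -> (forall t, T t -> 0 <= t) -> 0 <= c ->
  S !=set0 -> T !=set0 -> (forall s t, S s -> T t -> s * t <= c) -> ereal_sup S * ereal_sup T <= c.
Proof.
move=> S0 T0 c0 Sn Tn ST.
have sup0 (U : set (\bar R)) : (forall u, U u -> 0 <= u) -> U !=set0 ->
    0 <= ereal_sup U.
  by move=> U0 [u Uu]; apply: (le_trans (U0 _ Uu)); exact: ereal_sup_ubound.
apply: mule_ereal_sup_le => //; [exact: sup0|move=> s Ss|exact: sup0].
rewrite muleC; apply: mule_ereal_sup_le => //; [exact: S0| |exact: sup0].
by move=> t Tt; rewrite muleC; exact: ST.
Qed.

Let prekopa_leindler1 (F G H : R -> \bar R) :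
  measurable_fun setT H ->
  (forall x, 0 <= F x) -> (forall x, 0 <= G x) -> (forall x, 0 <= H x) ->
  (forall x y, F x * G y <= H (x + y)%R * H (x + y)%R) ->
  4%:E * (\int[leb]_x F x * \int[leb]_x G x) <=
  (\int[leb]_x H x) * (\int[leb]_x H x).
Proof.
move=> mH F0 G0 H0 FGH.
have I0 : 0 <= \int[leb]_x H x by exact: integral_ge0.
rewrite -lee_pdivlMl//.
rewrite [X in X * _ <= _]ge0_integralTE// [X in _ * X <= _]ge0_integralTE//.
apply: mule_ereal_sup2_le => //.
- by move=> _ [h _ <-]; exact: sintegral_ge0.
- by move=> _ [h _ <-]; exact: sintegral_ge0.
- by rewrite mule_ge0// ?mule_ge0// lee_fin invr_ge0 ler0n.
- by eexists; exists nnsfun0 => //= x; exact: F0.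
- by eexists; exists nnsfun0 => //= x; exact: G0.
move=> _ _ [f /= fF <-] [g /= gG <-].
rewrite lee_pdivlMl//.
rewrite -!integralT_nnsfun; apply: prekopa_leindler_nnsfun => // x y.
apply: le_trans (FGH x y); rewrite EFinM.
by apply: lee_pmul => //; rewrite lee_fin.
Qed.

(** The Prekopa-Leindler inequality at midpoints.  Writing the hypothesis with
    H (x + y) in place of H ((x + y) / 2) avoids rescaling in the induction on
    the dimension, at the price of the factor 4 ^ n; the square avoids the
    geometric mean of extended reals.  The induction step applies the
    one-dimensional case to the integrals over the slices. *)
Lemma prekopa_leindler n (F G H : 'rV[R]_n -> \bar R) :
  measurable_fun setT F -> measurable_fun setT G -> measurable_fun setT H ->
  (forall x, 0 <= F x) -> (forall x, 0 <= G x) -> (forall x, 0 <= H x) ->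
  (forall x y, F x * G y <= H (x + y)%R * H (x + y)%R) ->
  (4 ^+ n)%:E * (\int[lebesgue_rV R n]_x F x * \int[lebesgue_rV R n]_x G x) <=
  (\int[lebesgue_rV R n]_x H x) * (\int[lebesgue_rV R n]_x H x).
Proof.
elim: n F G H => [|n IH] F G H mF mG mH F0 G0 H0 FGH.
  rewrite !integral_dirac// !diracE !mem_set// !mul1e.
  by have := FGH 0%R 0%R; rewrite addr0.
rewrite !ge0_integral_rV_cons//.
have mc (K : 'rV[R]_(1 + n) -> \bar R) s : measurable_fun setT K ->
    measurable_fun setT (fun v => K (rV_cons (s, v))).
  by move=> mK; exact: measurableT_comp mK (measurable_rV_cons_r s).
have mi (K : 'rV[R]_(1 + n) -> \bar R) : measurable_fun setT K ->
    (forall x, 0 <= K x) ->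
    measurable_fun setT (fun s => \int[lebesgue_rV R n]_v K (rV_cons (s, v))).
  move=> mK K0; apply: (measurable_fun_fubini_tonelli_F (fun p => K (rV_cons p))) => //.
  exact: measurableT_comp mK (@measurable_rV_cons R n).
have p4 : 0 <= (4 ^+ n)%:E :> \bar R by rewrite lee_fin exprn_ge0.
rewrite exprS EFinM -muleA [X in _ * X <= _]muleA.
rewrite -[X in _ * (X * _) <= _]ge0_integralZl//; first last.
- by move=> s _; exact: integral_ge0.
- exact: mi.
apply: prekopa_leindler1 => //.
- exact: mi.
- by move=> s; rewrite mule_ge0//; exact: integral_ge0.
- by move=> s; exact: integral_ge0.
- by move=> s; exact: integral_ge0.
move=> s t; rewrite -muleA; apply: IH => //; try exact: mc.
by move=> u v; rewrite -rV_consD; exact: FGH.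
Qed.

End prekopa_leindler.

(** * Separation of a point from a convex set *)

Section separation.
Context {R : realType}.

Definition convex_rV n (S : set 'rV[R]_n) : Prop :=
  forall x y t, S x -> S y -> 0 <= t <= 1 -> S (t *: x + (1 - t) *: y).

Lemma convex_rV_sum n (S : set 'rV[R]_n) k (t : 'I_k -> R) (x : 'I_k -> 'rV[R]_n) :
  convex_rV S -> (forall i, 0 <= t i) -> \sum_i t i = 1 -> (forall i, S (x i)) ->
  S (\sum_i t i *: x i).
Proof.
move=> cS; elim: k t x => [|k IH] t x t0 t1 Sx.
  by move: t1; rewrite big_ord0 => /eqP; rewrite eq_sym oner_eq0.
rewrite big_ord_recl in t1; rewrite big_ord_recl.
have s0 : 0 <= \sum_(i < k) t (lift ord0 i) by apply: sumr_ge0.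
have [s_eq0|sN0] := eqVneq (\sum_(i < k) t (lift ord0 i)) 0.
  rewrite s_eq0 addr0 in t1; rewrite t1 scale1r big1 ?addr0// => i _.
  move: s_eq0 => /eqP; rewrite psumr_eq0//.
  by move=> /allP/(_ i (mem_index_enum i))/eqP ->; rewrite scale0r.
set s := \sum_(i < k) _ in t1 s0 sN0.
have sE : s = 1 - t ord0 by rewrite -t1 addrC addKr.
rewrite (_ : \sum_(i < k) _ =
    (1 - t ord0) *: \sum_(i < k) (t (lift ord0 i) / s) *: x (lift ord0 i)).
  apply: cS => //; first apply: IH => //.
  - by move=> i; rewrite divr_ge0.
  - by rewrite -mulr_suml divff.
  - by rewrite t0 -subr_ge0 -sE.
by rewrite -sE scaler_sumr; apply: eq_bigr => i _; rewrite scalerA mulrC divfK.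
Qed.

Lemma continuous_sumr (T : topologicalType) (I : finType) (F : I -> T -> R) :
  (forall i, continuous (F i)) -> continuous (fun x => \sum_i F i x).
Proof. by move=> cF x; apply: cvg_big => [|i _]; [exact: add_continuous|exact: cF]. Qed.

Lemma continuous_dotpl n (u : 'rV[R]_n) : continuous (fun x : 'rV[R]_n => dotp x u).
Proof.
under eq_fun do rewrite dotpE.
apply: continuous_sumr => i x.
apply: (@continuousM _ _ (fun x : 'rV[R]_n => x ord0 i)).
  exact: coord_continuous.
exact: cst_continuous.
Qed.

Lemma continuous_dotpr n (u : 'rV[R]_n) : continuous (fun x : 'rV[R]_n => dotp u x).
Proof. by under eq_fun do rewrite dotpC; exact: continuous_dotpl. Qed.

Lemma continuous_dotpxx n : continuous (fun x : 'rV[R]_n => dotp x x).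
Proof.
under eq_fun do rewrite dotpE.
apply: continuous_sumr => i x.
by apply: (@continuousM _ _ (fun x : 'rV[R]_n => x ord0 i)
  (fun x : 'rV[R]_n => x ord0 i)); exact: coord_continuous.
Qed.

Lemma closed_unit_compact n (A : set 'rV[R]_n) : closed A ->
  (forall x i, A x -> `|x ord0 i| <= 1) -> compact A.
Proof.
move=> cA A1.
have cbox : compact [set v : 'rV[R]_n | forall i, v ord0 i \in `[(-1 : R), 1]].
  apply: (@rV_compact _ _ (fun=> `[(-1 : R), 1]%classic)).
  by move=> _; exact: segment_compact.
apply: (subclosed_compact cA cbox) => x Ax i.
by rewrite in_itv/= -ler_norml A1.
Qed.

(** The point of least norm of the convex hull of the list is not 0, and it has
    positive scalar product with every point of the list: otherwise moving
    towards that point would decrease the norm. *)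
Lemma finite_separation n (S : set 'rV[R]_n) (s : seq 'rV[R]_n) :
  convex_rV S -> ~ S 0 -> (0 < size s)%N -> (forall x, x \in s -> S x) ->
  exists v : 'rV[R]_n, forall x, x \in s -> 0 < dotp x v.
Proof.
move=> cS S0 s0 sS; set k := size s.
pose x (i : 'I_k) := nth 0 s i.
have Sx i : S (x i) by apply: sS; rewrite mem_nth.
pose D := [set t : 'rV[R]_k | (forall i, 0 <= t ord0 i) /\ \sum_i t ord0 i = 1].
pose P (t : 'rV[R]_k) := \sum_i t ord0 i *: x i.
have D1 t i : D t -> t ord0 i <= 1.
  by move=> [t0 <-]; rewrite (bigD1 i)//= lerDl sumr_ge0.
have cD : compact D.
  apply: closed_unit_compact; last first.
    by move=> t i Dt; rewrite ger0_norm ?D1//; case: Dt.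
  rewrite (_ : D = \bigcap_(i in setT) [set t : 'rV[R]_k | 0 <= t ord0 i] `&`
                   [set t | \sum_i t ord0 i = 1]); last first.
    apply/seteqP; split=> t [t0 t1]; split=> // i; first by move=> _; exact: t0.
    exact: (t0 i I).
  apply: closedI; first apply: closed_bigI => i _.
    apply: (@closed_comp _ _ (fun t : 'rV[R]_k => t ord0 i) [set r | 0 <= r]).
      by move=> t _; exact: coord_continuous.
    exact: closed_ge.
  apply: (@closed_comp _ _ (fun t : 'rV[R]_k => \sum_i t ord0 i) [set r | r = 1]).
    by move=> t _; apply: continuous_sumr => i; exact: coord_continuous.
  exact: closed_eq.
have De i : D (delta_mx ord0 i).
  split=> [j|]; first by rewrite mxE eqxx/= ler0n.
  rewrite (bigD1 i)//= mxE !eqxx big1 ?addr0// => j ji.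
  by rewrite mxE eqxx (negbTE ji).
have Pe i : P (delta_mx ord0 i) = x i.
  rewrite /P (bigD1 i)//= mxE !eqxx scale1r big1 ?addr0// => j ji.
  by rewrite mxE eqxx (negbTE ji) scale0r.
have cP : continuous (fun t => dotp (P t) (P t)).
  have PE t j : P t ord0 j = \sum_i t ord0 i * x i ord0 j.
    by rewrite /P summxE; apply: eq_bigr => i _; rewrite mxE.
  under eq_fun do rewrite dotpE.
  apply: continuous_sumr => j t.
  have cj : continuous (fun t => P t ord0 j).
    under eq_fun do rewrite PE.
    apply: continuous_sumr => i u.
    apply: (@continuousM _ _ (fun t : 'rV[R]_k => t ord0 i)).
      exact: coord_continuous.
    exact: cst_continuous.
  by apply: (@continuousM _ _ (fun t => P t ord0 j) (fun t => P t ord0 j)); exact: cj.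
have [] := @EVT_min_rV R k (fun t => dotp (P t) (P t)) D.
- by exists (delta_mx ord0 (Ordinal s0)).
- exact: cD.
- exact: continuous_subspaceT.
move=> t /set_mem Dt tmin; exists (P t).
have v0 : P t != 0.
  apply/eqP => Pt0; apply: S0; rewrite -Pt0.
  by apply: convex_rV_sum => //; case: Dt.
have vv : 0 < dotp (P t) (P t) by rewrite dotp_gt0.
move=> y ys; have [i ->] : exists i, y = x i.
  by exists (Ordinal (etrans (index_mem y s) ys)); rewrite /x/= nth_index.
rewrite ltNge; apply/negP => xv.
pose a := dotp (P t) (P t); pose b := dotp (x i) (x i).
have b0 : 0 <= b by exact: dotp_ge0.
(* the step towards x i that minimises a (1 - e)^2 + b e^2, which bounds the
   squared norm when the scalar product is nonpositive *)
pose e := a / (a + b).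
have ab0 : 0 < a + b by rewrite ltr_pwDl.
have e0 : 0 < e by rewrite divr_gt0.
have e1 : e <= 1 by rewrite ler_pdivrMr// mul1r lerDl.
have Dte : D (e *: delta_mx ord0 i + (1 - e) *: t).
  have [t0 t1] := Dt; have [d0 d1] := De i; split.
    by move=> j; rewrite !mxE addr_ge0// mulr_ge0 ?subr_ge0 ?(ltW e0) ?ler0n.
  rewrite (eq_bigr (fun j => e * (delta_mx ord0 i : 'rV[R]_k) ord0 j +
    (1 - e) * t ord0 j)); last by move=> j _; rewrite !mxE.
  by rewrite big_split/= -!mulr_sumr d1 t1 !mulr1 addrC subrK.
have := tmin _ (mem_set Dte).
have -> : P (e *: delta_mx ord0 i + (1 - e) *: t) = e *: x i + (1 - e) *: P t.
  rewrite -Pe /P !scaler_sumr -big_split/=; apply: eq_bigr => j _.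
  have -> : (e *: delta_mx ord0 i + (1 - e) *: t) ord0 j =
      e * (delta_mx ord0 i : 'rV[R]_k) ord0 j + (1 - e) * t ord0 j.
    by rewrite !mxE.
  by rewrite scalerDl !scalerA.
rewrite !dotpDl !dotpDr !dotpZl !dotpZr (dotpC (P t) (x i)) -/a -/b.
apply/negP; rewrite -ltNge.
have eab : e * (a + b) = a by rewrite /e divfK// gt_eqF.
rewrite -subr_gt0 (_ : _ - _ = e * (a + (a - e * (a + b))) +
  2 * (e * (1 - e)) * - dotp (x i) (P t)); last by ring.
rewrite eab subrr addr0; apply: ltr_pwDl; first exact: mulr_gt0.
apply: mulr_ge0; last by rewrite oppr_ge0.
by apply: mulr_ge0 => //; apply: mulr_ge0; [exact: ltW|rewrite subr_ge0].
Qed.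

(** The point w may lie on the boundary of S, so S may have no point nearest
    to w.  If no unit vector separates, the open sets of the unit vectors that
    fail at a given point of S cover the unit sphere; by compactness finitely
    many points of S suffice, and these contradict the finite case. *)
Lemma convex_separation n (S : set 'rV[R]_n) (w : 'rV[R]_n) : (0 < n)%N ->
  convex_rV S -> ~ S w ->
  exists2 u : 'rV[R]_n, dotp u u = 1 & forall x, S x -> dotp x u <= dotp w u.
Proof.
move=> n0 cS Sw.
pose S' := [set x | S (w - x)].
have cS' : convex_rV S'.
  move=> x y t Sx Sy t01; rewrite /S'/=.
  rewrite (_ : w - _ = t *: (w - x) + (1 - t) *: (w - y)); first exact: cS.
  by apply/rowP => i; rewrite !mxE; ring.
have S'0 : ~ S' 0 by rewrite /S'/= subr0.
suff [u u1 uS] : exists2 u : 'rV[R]_n, dotp u u = 1 &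
    forall x, S' x -> 0 <= dotp x u.
  exists u => // x Sx; rewrite -subr_ge0 -dotpNl -dotpDl; apply: uS.
  by rewrite /S'/= subKr.
pose B := [set u : 'rV[R]_n | dotp u u = 1].
apply: contrapT => nu.
have cB : compact B.
  apply: closed_unit_compact.
    apply: (@closed_comp _ _ (fun u : 'rV[R]_n => dotp u u) [set r | r = 1]).
      by move=> t _; exact: continuous_dotpxx.
    exact: closed_eq.
  move=> x i /= x1; rewrite -(@ler_pXn2r _ 2)// ?nnegrE// expr1n real_normK ?num_real//.
  rewrite -x1 dotpE (bigD1 i)//= -expr2 lerDl sumr_ge0// => j _.
  by rewrite -expr2 sqr_ge0.
move: cB; rewrite compact_cover => /(_ _ S' (fun x => [set u | dotp x u < 0])).
case.
- move=> x _; apply: (@open_comp _ _ (fun u => dotp x u) [set r | r < 0]).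
    by move=> u _; exact: continuous_dotpr.
  exact: open_lt.
- move=> u u1; apply: contrapT => nx; apply: nu; exists u => // x Sx.
  by rewrite leNgt; apply/negP => xu; apply: nx; exists x.
move=> D DS Bcov.
have B1 : B (delta_mx ord0 (Ordinal n0)).
  rewrite /B/= dotpE (bigD1 (Ordinal n0))//= !mxE !eqxx mulr1 big1 ?addr0// => i iN.
  by rewrite !mxE (negbTE iN) andbF mul0r.
have D0 : (0 < size (enum_fset D))%N.
  have [x Dx _] := Bcov _ B1.
  have {}Dx : x \in enum_fset D by exact: Dx.
  by case: (enum_fset D) Dx.
have [] := finite_separation cS' S'0 D0.
  by move=> x xD; have := DS x xD; rewrite inE.
move=> v vD.
have v0 : v != 0.
  apply/eqP => v0; have [x Dx _] := Bcov _ B1.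
  by have := vD x Dx; rewrite v0 dotp0r ltxx.
have [x Dx] := Bcov _ (normalize_dotp v0).
rewrite /= dotpZr; apply/negP; rewrite -leNgt mulr_ge0 ?invr_ge0 ?sqrtr_ge0//.
by apply: ltW; exact: vD.
Qed.

End separation.

(** * Log-concave functions *)

Section log_concave_theory.
Context {R : realType} (n : nat).
Variables (f : 'rV[R]_n -> R).
Hypothesis lcf : log_concave f.

Lemma log_concave_ge0 x : 0 <= f x.
Proof. by have [psi [_ _ fE]] := lcf; rewrite -lee_fin fE expeR_ge0. Qed.

Let log_concaveP : exists psi : 'rV[R]_n -> \bar R, convex_efun psi /\
  forall x, (exists2 a, psi x = a%:E & f x = expR (- a)) \/
            (psi x = +oo%E /\ f x = 0).
Proof.
have [psi [psiNy cpsi fE]] := lcf; exists psi; split=> // x.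
have := fE x; have := psiNy x.
case: (psi x) => [a _ [fx]|_ [fx]|//]; [left|right]; last by [].
by exists a.
Qed.

Lemma log_concave_superlevel (c : R) : convex_rV [set x | c <= f x].
Proof.
have [psi [cpsi psiP]] := log_concaveP.
move=> x y t /= cx cy t01.
have [c0|c0] := leP c 0; first exact: le_trans (log_concave_ge0 _).
have pos z : c <= f z -> exists2 a, psi z = a%:E & a <= - ln c.
  move=> cz; case: (psiP z) => [[a pa fa]|[_ f0]]; last first.
    by move: cz; rewrite f0 leNgt c0.
  by exists a => //; rewrite lerNr -ler_expR lnK ?posrE// -fa.
have [a pa ac] := pos _ cx; have [b pb bc] := pos _ cy.
have := cpsi x y t t01; rewrite pa pb -!EFinM -EFinD.
case: (psiP (t *: x + (1 - t) *: y)) => [[d -> ->]|[-> _]]; last first.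
  by rewrite leye_eq.
rewrite lee_fin => dab; rewrite -(@lnK _ c) ?posrE// ler_expR lerNr.
apply: (le_trans dab); have /andP[t0 t1] := t01.
have -> : - ln c = t * (- ln c) + (1 - t) * (- ln c) by ring.
by apply: lerD; apply: ler_wpM2l; rewrite // subr_ge0.
Qed.

(** Log-concavity at the weights k / (k + 1) and 1 / (k + 1), raised to the
    power k + 1 so that only integer exponents occur.  It serves with k + 1 = n
    to compare f with its dilate, with k = 1 at midpoints, and for all k along
    a segment. *)
Lemma log_concave_exp (k : nat) x y :
  f x ^+ k * f y <= f ((k.+1%:R)^-1 *: (k%:R *: x + y)) ^+ k.+1.
Proof.
have [psi [cpsi psiP]] := log_concaveP.
pose t : R := k%:R / k.+1%:R.
have k0 : (0 : R) < k.+1%:R by rewrite ltr0n.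
have t1 : 1 - t = (k.+1%:R)^-1.
  by rewrite /t -[X in X - _](divff (lt0r_neq0 k0)) -mulrBl -natrB// subSnn mul1r.
have -> : (k.+1%:R)^-1 *: (k%:R *: x + y) = t *: x + (1 - t) *: y.
  by rewrite t1 scalerDr scalerA mulrC.
have t01 : 0 <= t <= 1.
  by rewrite divr_ge0//= ler_pdivrMr// mul1r ler_nat.
have rhs0 z : 0 <= f z ^+ k.+1 by rewrite exprn_ge0// log_concave_ge0.
case: (psiP y) => [[b pb fb]|[_ ->]]; last by rewrite mulr0.
have [k_eq0|kN0] := eqVneq k 0%N.
  have -> : t = 0 by rewrite /t k_eq0 mul0r.
  by rewrite k_eq0 expr0 mul1r scale0r subr0 scale1r add0r expr1.
case: (psiP x) => [[a pa fa]|[_ ->]]; last by rewrite expr0n (negbTE kN0) mul0r.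
have := cpsi x y t t01; rewrite pa pb -!EFinM -EFinD.
case: (psiP (t *: x + (1 - t) *: y)) => [[d -> ->]|[-> _]]; last first.
  by rewrite leye_eq.
rewrite lee_fin => dab; rewrite fa fb -!expRM_natl -expRD ler_expR.
rewrite -(ler_pM2l k0) in dab.
have e1 : k.+1%:R * (t * a + (1 - t) * b) = k%:R * a + b.
  rewrite t1 /t mulrDr mulrA (mulrC _ (k%:R / _)) divfK ?lt0r_neq0//.
  by rewrite mulrA divff ?lt0r_neq0// mul1r.
by rewrite e1 in dab; lra.
Qed.

End log_concave_theory.

Section almost_everywhere.
Local Open Scope ereal_scope.

(** Here h1 need not be measurable: h2, modified to be 0 or +oo on the null
    set, bounds h1 from both sides. *)
Lemma integral_ae_eq_measurable d (T : measurableType d) (R : realType)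
    (mu : {measure set T -> \bar R}) (N : set T) (h1 h2 : T -> \bar R) :
  measurable N -> mu N = 0 -> measurable_fun setT h2 ->
  (forall x, ~ N x -> h1 x = h2 x) ->
  \int[mu]_x h1 x = \int[mu]_x h2 x.
Proof.
move=> mN N0 mh2 h12.
have ge0 (g1 g2 : T -> \bar R) : measurable_fun setT g2 ->
    (forall x, 0 <= g1 x) -> (forall x, 0 <= g2 x) ->
    (forall x, ~ N x -> g1 x = g2 x) ->
    \int[mu]_x g1 x = \int[mu]_x g2 x.
  move=> mg2 g10 g20 g12.
  have mNi : measurable_fun setT (fun x => (\1_N x)%:E : \bar R).
    exact/measurable_EFinP/measurable_indic.
  have mNCi : measurable_fun setT (fun x => (\1_(~` N) x)%:E : \bar R).
    by apply/measurable_EFinP/measurable_indic; exact: measurableC.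
  have mhi : measurable_fun setT (fun x => g2 x + +oo * (\1_N x)%:E).
    by apply: emeasurable_funD => //; exact: measurable_funeM.
  have mlo : measurable_fun setT (fun x => g2 x * (\1_(~` N) x)%:E).
    exact: emeasurable_funM.
  have hi0 x : 0 <= g2 x + +oo * (\1_N x)%:E.
    by rewrite adde_ge0// mule_ge0// lee_fin.
  have lo0 x : 0 <= g2 x * (\1_(~` N) x)%:E by rewrite mule_ge0// lee_fin.
  have aeN P : (forall x, ~ N x -> P x) -> {ae mu, forall x, P x}.
    by move=> NP; exists N; split=> // x /= Px; apply: contrapT => /NP.
  apply/eqP; rewrite eq_le; apply/andP; split.
    rewrite (_ : \int[mu]_x g2 x = \int[mu]_x (g2 x + +oo * (\1_N x)%:E)).
      apply: le_integralT => // x.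
      have [Nx|Nx] := pselect (N x).
        by rewrite indicE mem_set//= mule1 addey ?leey// gt_eqF// (lt_le_trans (ltNyr 0)).
      by rewrite indicE memNset//= mule0 adde0 g12.
    apply: ge0_ae_eq_integral => //; apply: aeN => x Nx _.
    by rewrite indicE memNset//= mule0 adde0.
  rewrite (_ : \int[mu]_x g2 x = \int[mu]_x (g2 x * (\1_(~` N) x)%:E)).
    apply: le_integralT => // x.
    have [Nx|Nx] := pselect (N x).
      by rewrite indicE memNset//= ?mule0//; apply.
    by rewrite indicE mem_set//= mule1 g12.
  apply: ge0_ae_eq_integral => //; apply: aeN => x Nx _.
  by rewrite indicE mem_set//= mule1.
rewrite integralE [RHS]integralE; congr (_ - _); apply: ge0 => //.
- exact: measurable_funepos.
- by move=> x Nx; rewrite !funeposE h12.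
- exact: measurable_funeneg.
- by move=> x Nx; rewrite !funenegE h12.
Qed.

Context {R : realType}.

Lemma ae_affine n (c : R) (d : 'rV[R]_n) (P : 'rV[R]_n -> Prop) : (0 < c)%R ->
  {ae lebesgue_rV R n, forall x, P x} ->
  {ae lebesgue_rV R n, forall x, P (c *: x + d)%R}.
Proof.
move=> c0 [N [mN N0 PN]].
have mA : measurable_fun setT (fun x : 'rV[R]_n => c *: x + d)%R.
  by apply: measurable_funD_rV => //; apply: measurable_funZ_rV.
have mN' : measurable ((fun x : 'rV[R]_n => c *: x + d)%R @^-1` N).
  by rewrite -[X in measurable X]setTI; exact: mA.
exists ((fun x : 'rV[R]_n => c *: x + d)%R @^-1` N); split=> //; last first.
  by move=> x /= Px; apply: PN.
rewrite -(setIT (_ @^-1` _)) -integral_indic//.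
have miN : measurable_fun setT (fun x => (\1_N x)%:E : \bar R).
  exact/measurable_EFinP/measurable_indic.
have -> : \int[lebesgue_rV R n]_x
    (\1_((fun x : 'rV[R]_n => c *: x + d)%R @^-1` N) x)%:E =
    \int[lebesgue_rV R n]_x (\1_N (c *: x + d)%R)%:E by apply: eq_integral.
rewrite (@ge0_integral_scale R n c (fun x => (\1_N (x + d)%R)%:E))//; first last.
- by apply: measurableT_comp miN _; apply: measurable_funD_rV.
rewrite (ge0_integral_rV_translation d (g := fun x => (\1_N x)%:E))//.
transitivity ((c ^- n)%:E * 0%:E); last exact: mule0.
congr (_ * _); rewrite integral_indic// setIT; exact: N0.
Qed.

End almost_everywhere.

Section max_at_origin.
Local Open Scope ereal_scope.
Context {R : realType} (n : nat).
Variables (f : 'rV[R]_n -> R).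
Hypothesis lcf : log_concave f.
Hypothesis f1 : \int[lebesgue_rV R n]_x (f x)%:E != 0.
Hypothesis fmax : {ae lebesgue_rV R n, forall x, (f x <= f 0)%R}.

(** If f y > f 0 then, for almost every x, the points (k y + x) / (k + 1) all
    satisfy the almost everywhere bound, and log-concavity gives
    f x <= f 0 (f 0 / f y)^k for every k; so f would vanish almost everywhere. *)
Lemma log_concave_ae_max y : (f y <= f 0%R)%R.
Proof.
rewrite leNgt; apply/negP => fy; move/eqP: f1; apply.
have f00 := log_concave_ge0 lcf 0%R.
have fy0 : (0 < f y)%R by exact: le_lt_trans fy.
suff [N [mN N0 fN]] : {ae lebesgue_rV R n, forall x, f x = 0%R}.
  rewrite (@integral_ae_eq_measurable _ _ _ _ N _ (cst 0))//.
    exact: integral0.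
  by move=> x Nx; congr _%:E; apply: contrapT => /fN.
have : {ae lebesgue_rV R n, forall x, forall k : nat,
    (f ((k.+1%:R)^-1 *: (k%:R *: y + x)) <= f 0)%R}.
  apply: ae_foralln => k.
  have k0 : (0 < (k.+1%:R)^-1 :> R)%R by rewrite invr_gt0 ltr0n.
  have := ae_affine ((k.+1%:R)^-1 *: (k%:R *: y))%R k0 fmax.
  apply: filterS => x; by rewrite scalerDr addrC.
apply: filterS => x xk; apply/eqP; rewrite eq_le log_concave_ge0// andbT.
have q k : (f x <= f 0%R * (f 0%R / f y) ^+ k)%R.
  rewrite expr_div_n mulrA -exprS ler_pdivlMr ?exprn_gt0//.
  rewrite mulrC; apply: (le_trans (log_concave_exp lcf k y x)).
  by rewrite lerXn2r// ?nnegrE ?log_concave_ge0.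
have cv : ((f 0 * (f 0 / f y) ^+ k)%R @[k --> \oo] --> (f 0 * 0)%R).
  apply: cvgM; first exact: cvg_cst.
  apply: cvg_expr; rewrite ger0_norm; last by rewrite divr_ge0// ltW.
  by rewrite ltr_pdivrMr// mul1r.
rewrite mulr0 in cv.
rewrite -(cvg_lim (@Rhausdorff R) cv).
by apply: limr_ge; [apply: cvgP cv|exact: nearW].
Qed.

End max_at_origin.

Section borel_envelopes.
Context {R : realType} (n : nat).

(** Integrals are computed with lo and hi, which are Borel, whereas log-concavity
    is an everywhere property and is used on f. *)
Definition borel_envelopes (f lo hi : 'rV[R]_n -> R) : Prop :=
  [/\ measurable_fun setT lo, measurable_fun setT hi,
      forall x, 0 <= lo x, forall x, lo x <= f x <= hi x &
      exists N, [/\ measurable N, lebesgue_rV R n N = 0%E &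
        forall x, ~ N x -> lo x = f x /\ hi x = f x]].

Lemma borel_envelopes_exist (f : 'rV[R]_n -> R) (M : R) :
  lebesgue_measurable f -> (forall x, 0 <= f x <= M) ->
  exists lo hi, borel_envelopes f lo hi.
Proof.
move=> [g mg [N [mN N0 fg]]] f01.
have fgN x : ~ N x -> g x = f x.
  by move=> Nx; apply/esym; apply: contrapT => /fg.
have i1 x : N x -> \1_N x = 1 :> R by move=> Nx; rewrite indicE mem_set.
have i0 x : ~ N x -> \1_N x = 0 :> R by move=> Nx; rewrite indicE memNset.
have mi : measurable_fun setT (\1_N : 'rV[R]_n -> R) by exact: measurable_indic.
pose lo x := g x * (1 - \1_N x); pose hi x := lo x + M * \1_N x.
have mlo : measurable_fun setT lo.
  by apply: measurable_funM => //; exact: measurable_funB.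
exists lo, hi; split.
- exact: mlo.
- by apply: measurable_funD => //; exact: measurable_funM.
- move=> x; rewrite /lo; have [Nx|Nx] := pselect (N x).
    by rewrite i1// subrr mulr0.
  by rewrite i0// subr0 mulr1 fgN//; have /andP[] := f01 x.
- move=> x; rewrite /hi /lo; have /andP[f0 fM] := f01 x.
  have [Nx|Nx] := pselect (N x).
    by rewrite i1// subrr !mulr0 mulr1 add0r f0.
  by rewrite i0// subr0 mulr1 mulr0 addr0 fgN// lexx.
- exists N; split=> // x Nx; rewrite /hi /lo i0// subr0 mulr1 mulr0 addr0.
  by rewrite fgN.
Qed.

End borel_envelopes.

(** * Moments of an isotropic log-concave density *)

Section isotropic_density.
Local Open Scope ereal_scope.
Context {R : realType} (n : nat).
Variables (f lo hi : 'rV[R]_n -> R).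
Local Notation lam := (lebesgue_rV R n).
Hypothesis lcf : log_concave f.
Hypothesis env : borel_envelopes f lo hi.
Hypothesis f_int : \int[lam]_x (f x)%:E = 1.
Hypothesis f_iso : isotropic f.

Let mlo : measurable_fun setT lo. Proof. by case: env. Qed.
Let mhi : measurable_fun setT hi. Proof. by case: env. Qed.
Let lo0 x : (0 <= lo x)%R. Proof. by case: env. Qed.
Let lo_f x : (lo x <= f x)%R. Proof. by case: env => _ _ _ /(_ x)/andP[]. Qed.
Let f_hi x : (f x <= hi x)%R. Proof. by case: env => _ _ _ /(_ x)/andP[]. Qed.
Let hi0 x : (0 <= hi x)%R.
Proof. exact: le_trans (le_trans (lo0 x) (lo_f x)) (f_hi x). Qed.

Let integral_lo (h : 'rV[R]_n -> R) : measurable_fun setT h ->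
  \int[lam]_x (h x * f x)%:E = \int[lam]_x (h x * lo x)%:E.
Proof.
case: env => _ _ _ _ [N [mN N0 fN]] mh.
apply: (integral_ae_eq_measurable mN N0).
  by apply/measurable_EFinP; exact: measurable_funM.
by move=> x /fN[-> _].
Qed.

Let integral_hi (h : 'rV[R]_n -> R) : measurable_fun setT h ->
  \int[lam]_x (h x * hi x)%:E = \int[lam]_x (h x * lo x)%:E.
Proof.
case: env => _ _ _ _ [N [mN N0 fN]] mh.
apply: (integral_ae_eq_measurable mN N0).
  by apply/measurable_EFinP; exact: measurable_funM.
by move=> x /fN[-> ->].
Qed.

Let int_lo : \int[lam]_x (lo x)%:E = 1.
Proof.
rewrite -f_int; have := @integral_lo (cst 1%R) (measurable_cst _).
by under eq_integral do rewrite /= mul1r;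
   under [X in _ = X -> _]eq_integral do rewrite /= mul1r.
Qed.

Lemma integral_hi_envelope : \int[lam]_x (hi x)%:E = 1.
Proof.
rewrite -int_lo; have := @integral_hi (cst 1%R) (measurable_cst _).
by under eq_integral do rewrite /= mul1r;
   under [X in _ = X -> _]eq_integral do rewrite /= mul1r.
Qed.

Let mcoord i : measurable_fun setT (fun x : 'rV[R]_n => x ord0 i).
Proof. exact: measurable_rV_coord. Qed.

Let int_coord i : \int[lam]_x (x ord0 i * lo x)%:E = 0.
Proof. by rewrite -integral_lo//; case: f_iso => ->. Qed.

Let int_coord2 i j :
  \int[lam]_x (x ord0 i * x ord0 j * lo x)%:E = (i == j)%:R%:E.
Proof.
rewrite -(@integral_lo (fun x => x ord0 i * x ord0 j)%R); last exact: measurable_funM.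
by case: f_iso => _ ->.
Qed.

Let integrable_ge0 (h : 'rV[R]_n -> R) : measurable_fun setT h ->
  (forall x, (0 <= h x)%R) -> \int[lam]_x (h x)%:E < +oo ->
  lam.-integrable setT (fun x => (h x)%:E).
Proof.
move=> mh h0 hoo; apply/integrableP; split; first exact/measurable_EFinP.
by under eq_integral do rewrite gee0_abs ?lee_fin//.
Qed.

Let integrable_lo : lam.-integrable setT (fun x => (lo x)%:E).
Proof. by apply: integrable_ge0 => //; rewrite int_lo ltry. Qed.

Let integrable_sqr i : lam.-integrable setT (fun x => (x ord0 i * x ord0 i * lo x)%:E).
Proof.
apply: integrable_ge0.
- by apply: measurable_funM => //; exact: measurable_funM.
- by move=> x; rewrite mulr_ge0// -expr2 sqr_ge0.
- by rewrite int_coord2 ltry.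
Qed.

Let integrable_coord2 i j :
  lam.-integrable setT (fun x => (x ord0 i * x ord0 j * lo x)%:E).
Proof.
apply: le_integrable (integrableD measurableT (integrable_sqr i) (integrable_sqr j)).
- exact: measurableT.
- apply/measurable_EFinP; apply: measurable_funM => //; exact: measurable_funM.
- move=> x _; rewrite -EFinD !abse_EFin lee_fin -mulrDl !normrM (ger0_norm (lo0 x)).
  apply: ler_wpM2r => //; rewrite [leRHS]ger0_norm; last by rewrite addr_ge0// -expr2 sqr_ge0.
  rewrite -!expr2 -(real_normK (num_real (x ord0 i))) -(real_normK (num_real (x ord0 j))).
  set a := `|_|%R; set b := `|_|%R.
  have := sqr_ge0 (a - b)%R; have := sqr_ge0 (a + b)%R; nra.
Qed.

Let integrable_coord i : lam.-integrable setT (fun x => (x ord0 i * lo x)%:E).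
Proof.
apply: le_integrable (integrableD measurableT integrable_lo (integrable_sqr i)).
- exact: measurableT.
- by apply/measurable_EFinP; exact: measurable_funM.
- move=> x _; rewrite -EFinD !abse_EFin lee_fin -[X in (X + _)%R]mul1r -mulrDl.
  rewrite !normrM (ger0_norm (lo0 x)).
  apply: ler_wpM2r => //; rewrite [leRHS]ger0_norm; last by rewrite addr_ge0// -expr2 sqr_ge0.
  rewrite -expr2 -(real_normK (num_real (x ord0 i))).
  by set a := `|_|%R; have := sqr_ge0 (a - 1)%R; have := sqr_ge0 a; nra.
Qed.

Section direction.
Variable u : 'rV[R]_n.
Local Notation p := (fun x : 'rV[R]_n => dotp x u).

Let mp : measurable_fun setT p. Proof. exact: measurable_dotpl. Qed.

Let sqr_expand x : (dotp x u ^+ 2 * lo x)%:E =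
  \sum_i \sum_j (u ord0 i * u ord0 j)%:E * (x ord0 i * x ord0 j * lo x)%:E.
Proof.
under eq_bigr do under eq_bigr do rewrite -EFinM.
under eq_bigr do rewrite sumEFin.
rewrite sumEFin expr2 dotpE mulr_suml mulr_suml; congr _%:E.
apply: eq_bigr => i _; rewrite mulr_sumr mulr_suml; apply: eq_bigr => j _; ring.
Qed.

Let lin_expand x : (dotp x u * lo x)%:E =
  \sum_i (u ord0 i)%:E * (x ord0 i * lo x)%:E.
Proof.
under eq_bigr do rewrite -EFinM.
rewrite sumEFin dotpE mulr_suml; congr _%:E.
by apply: eq_bigr => i _; ring.
Qed.

Let integrable_lin : lam.-integrable setT (fun x => (dotp x u * lo x)%:E).
Proof.
under eq_fun do rewrite lin_expand.
by apply: integrable_sum => // i _; exact: (integrableZl measurableT).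
Qed.

Let integrable_quad : lam.-integrable setT (fun x => (dotp x u ^+ 2 * lo x)%:E).
Proof.
under eq_fun do rewrite sqr_expand.
apply: integrable_sum => // i _; apply: integrable_sum => // j _.
exact: (integrableZl measurableT).
Qed.

Let int_lin : \int[lam]_x (dotp x u * lo x)%:E = 0.
Proof.
under eq_integral do rewrite lin_expand.
rewrite integral_sum//; last by move=> i; exact: (integrableZl measurableT).
by rewrite big1// => i _; rewrite integralZl// int_coord mule0.
Qed.

Let int_quad : \int[lam]_x (dotp x u ^+ 2 * lo x)%:E = (dotp u u)%:E.
Proof.
under eq_integral do rewrite sqr_expand.
rewrite integral_sum//; last first.
  by move=> i; apply: integrable_sum => // j _; exact: (integrableZl measurableT).
rewrite dotpE -sumEFin; apply: eq_bigr => i _.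
rewrite integral_sum//; last by move=> j; exact: (integrableZl measurableT).
rewrite (bigD1 i)//= integralZl// int_coord2 eqxx mule1 big1 ?adde0// => j ji.
by rewrite integralZl// int_coord2 eq_sym (negbTE ji) mule0.
Qed.

Let mabs : measurable_fun setT (fun x => `|dotp x u|)%R.
Proof. exact: measurableT_comp. Qed.

Hypothesis u1 : dotp u u = 1%R.

(** An isotropic log-concave density cannot be concentrated near a hyperplane.
    Suppose that p = <x, u> has mean absolute value at most M = 1/7.  Then
    |p| <= 4 M with probability at least 3/4 by Markov, while p has variance
    one.  Apply Prekopa-Leindler to f p^2 / 4 and to f restricted to
    |p| <= 4 M: at the midpoint z of x and y one has
    |p x| / 2 <= |p z| + 2 M, so 3/16 <= (M + 2 M)^2 = 9/49, which is false. *)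
Let mean_abs_lower_bound : (7^-1)%:E < \int[lam]_x (`|dotp x u| * lo x)%:E.
Proof.
rewrite ltNge; apply/negP => small.
pose M : R := (7^-1)%R.
pose B := [set x : 'rV[R]_n | (`|dotp x u| <= 4 * M)%R].
have mB : measurable B.
  rewrite (_ : B = setT `&` (fun x => `|dotp x u|)%R @^-1` `]-oo, (4 * M)%R]).
    by apply: mabs => //; exact: measurable_itv.
  by rewrite setTI; apply/seteqP; split=> x /=; rewrite in_itv.
have miB : measurable_fun setT (\1_B : 'rV[R]_n -> R) by exact: measurable_indic.
pose F x := (lo x * (dotp x u ^+ 2 / 4))%:E.
pose G x := (lo x * \1_B x)%:E.
pose H x := (hi (2^-1 *: x)%R * (`|dotp (2^-1 *: x) u| + 2 * M))%:E.
have mF : measurable_fun setT F.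
  apply/measurable_EFinP; apply: measurable_funM => //.
  by apply: measurable_funM => //; exact: measurable_funX.
have mG : measurable_fun setT G.
  by apply/measurable_EFinP; exact: measurable_funM.
have mH1 : measurable_fun setT (fun x => (hi x * (`|dotp x u| + 2 * M))%:E).
  apply/measurable_EFinP; apply: measurable_funM => //.
  exact: measurable_funD.
have mH : measurable_fun setT H.
  by apply: measurableT_comp mH1 _; exact: measurable_funZ_rV.
have M0 : (0 < M)%R by rewrite invr_gt0.
have H10 x : 0 <= (hi x * (`|dotp x u| + 2 * M))%:E :> \bar R.
  by rewrite lee_fin mulr_ge0// addr_ge0// mulr_ge0// ltW.
have F0 x : 0 <= F x by rewrite lee_fin mulr_ge0// mulr_ge0// sqr_ge0.
have G0 x : 0 <= G x by rewrite lee_fin mulr_ge0.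
have H0 x : 0 <= H x by exact: H10.
have FGH x y : F x * G y <= H (x + y)%R * H (x + y)%R.
  rewrite /F /G /H -!EFinM lee_fin -expr2.
  set z := (2^-1 *: (x + y))%R.
  have [By|By] := pselect (B y); last first.
    by rewrite [in leLHS]indicE memNset// !mulr0 sqr_ge0.
  rewrite [in leLHS]indicE mem_set// mulr1.
  have ff : (lo x * lo y <= hi z ^+ 2)%R.
    have := log_concave_exp lcf 1 x y; rewrite expr1 scale1r -/z => fxy.
    apply: (@le_trans _ _ (f x * f y)%R); first by rewrite ler_pM.
    apply: (le_trans fxy); rewrite lerXn2r// nnegrE//.
    exact: log_concave_ge0.
  have pp : (dotp x u ^+ 2 / 4 <= (`|dotp z u| + 2 * M) ^+ 2)%R.
    have -> : (dotp x u ^+ 2 / 4 = (`|dotp x u| / 2) ^+ 2)%R.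
      by rewrite expr_div_n real_normK ?num_real// -natrX.
    apply: lerXn2r; rewrite ?nnegrE ?divr_ge0// ?addr_ge0// ?mulr_ge0// ?(ltW M0)//.
    have -> : (dotp z u = (dotp x u + dotp y u) / 2)%R.
      by rewrite /z dotpZl dotpDl mulrC.
    have := ler_normB (dotp x u + dotp y u)%R (dotp y u).
    rewrite addrK normrM [ `|2^-1|%R]ger0_norm ?invr_ge0// => tri.
    by have : (`|dotp y u| <= 4 * M)%R := By; lra.
  rewrite (_ : _ * _ * _ = (lo x * lo y) * (dotp x u ^+ 2 / 4))%R; last by ring.
  rewrite exprMn; apply: ler_pM => //; first exact: mulr_ge0.
  by rewrite divr_ge0 ?sqr_ge0.
have := prekopa_leindler mF mG mH F0 G0 H0 FGH.
have -> : \int[lam]_x F x = (4^-1)%:E.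
  have q1 : \int[lam]_x (dotp x u ^+ 2 * lo x)%:E = 1 by rewrite int_quad u1.
  rewrite -[RHS]mule1 -[in RHS]q1 -integralZl//.
  by apply: eq_integral => x _; rewrite /F -EFinM; congr _%:E; ring.
have HE : \int[lam]_x H x <= (2 ^+ n * (3 * M))%:E.
  rewrite (ge0_integral_scale (c := 2^-1) _ mH1 H10) ?invr_gt0//.
  rewrite exprVn invrK EFinM; apply: lee_wpmul2l; first by rewrite lee_fin exprn_ge0.
  have -> : \int[lam]_x (hi x * (`|dotp x u| + 2 * M))%:E =
      \int[lam]_x (`|dotp x u| * lo x)%:E + (2 * M)%:E.
    under eq_integral do rewrite mulrC.
    rewrite integral_hi; last exact: measurable_funD.
    under eq_integral do rewrite mulrDl EFinD [(2 * M * _)%:E]EFinM.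
    rewrite ge0_integralD//; first last.
    - exact/measurable_EFinP/measurable_funM.
    - by move=> x _; rewrite mule_ge0// lee_fin// mulr_ge0// ltW.
    - exact/measurable_EFinP/measurable_funM.
    - by move=> x _; rewrite lee_fin mulr_ge0.
    by rewrite integralZl// int_lo mule1.
  rewrite (_ : (3 * M = M + 2 * M)%R); last by ring.
  by rewrite EFinD leeD2r.
have GE : (3 / 4)%:E <= \int[lam]_x G x.
  rewrite -(@leeD2rE _ (4^-1)%:E)// -EFinD (_ : (3 / 4 + 4^-1 = 1 :> R)%R); last by lra.
  apply: (@le_trans _ _ (\int[lam]_x G x + (4 * M)^-1%:E * \int[lam]_x (`|dotp x u| * lo x)%:E)).
    rewrite -ge0_integralZl//; first last.
    - by rewrite lee_fin invr_ge0 mulr_ge0// ltW.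
    - by move=> x _; rewrite lee_fin mulr_ge0.
    - exact/measurable_EFinP/measurable_funM.
    rewrite -ge0_integralD//; first last.
    - apply/measurable_EFinP; apply: measurable_funM => //; exact: measurable_funM.
    - by move=> x _; rewrite -EFinM lee_fin !mulr_ge0// invr_ge0 mulr_ge0// ltW.
    rewrite -int_lo; apply: le_integralT => x; rewrite ?lee_fin//.
    have [By|By] := pselect (B x).
      by rewrite indicE mem_set// mulr1 lerDl !mulr_ge0// invr_ge0 mulr_ge0// ltW.
    rewrite indicE memNset// mulr0 add0r mulrA ler_peMl//.
    have {}By : (4 * M < `|dotp x u|)%R by rewrite ltNge; apply/negP.
    by rewrite mulrC ler_pdivlMr ?mul1r ?ltW// mulr_gt0.
  apply: leeD2l; rewrite (_ : 4^-1%:E = (4 * M)^-1%:E * M%:E); last first.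
    by rewrite -EFinM invfM -mulrA mulVf ?gt_eqF// mulr1.
  by apply: lee_wpmul2l => //; rewrite lee_fin invr_ge0 mulr_ge0// ltW.
have IH0 : 0 <= \int[lam]_x H x by exact: integral_ge0.
move=> /le_trans/(_ (lee_pmul IH0 IH0 HE HE)) PL.
have {PL} : (4 ^+ n)%:E * ((4^-1)%:E * (3 / 4)%:E) <=
    (2 ^+ n * (3 * M))%:E * (2 ^+ n * (3 * M))%:E.
  apply: le_trans PL.
  apply: lee_wpmul2l; first by rewrite lee_fin exprn_ge0.
  by apply: lee_wpmul2l => //; rewrite lee_fin invr_ge0.
rewrite -!EFinM lee_fin.
rewrite (_ : 2 ^+ n * (3 * M) * (2 ^+ n * (3 * M)) = 4 ^+ n * (9 * M ^+ 2))%R; last first.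
  rewrite (_ : 4 = 2 * 2 :> R)%R; last by ring.
  by rewrite exprMn; ring.
rewrite ler_pM2l ?exprn_gt0// /M; lra.
Qed.

Variables (K kap : R) (lambda : R).
Hypothesis lambda0 : (0 < lambda)%R.
Hypothesis lambdaK : ((lambda ^+ n)^-1 <= K)%R.
Hypothesis kap0 : (0 < kap)%R.
Hypothesis kapK : (kap * K <= 784^-1)%R.

(** Beyond the hyperplane dotp x u = 1/56, the density cannot drop everywhere by
    the factor kap under the dilation by lambda.  Otherwise the positive part
    of p = dotp x u is essentially bounded by 1/56: the mean of |p| is the mean
    of |p| + p, which is at most 1/28 where p <= 1/56, while elsewhere
    |p| + p <= p^2 / 28 + 28 and the constant 28 is integrated against
    kap f (lambda x).  In total 1/28 + 1/28 + 28 / 784 < 1/7, against the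
    previous lower bound. *)
Lemma isotropic_deep_halfspace :
  exists2 x, (56^-1 < dotp x u)%R & (f x <= kap * f (lambda *: x)%R)%R -> False.
Proof.
apply: contrapT => nx.
have {}nx x : (dotp x u <= 56^-1)%R \/ (f x <= kap * f (lambda *: x)%R)%R.
  have [|xu] := leP (dotp x u) (56^-1)%R; [by left|right].
  by apply: contrapT => fx; apply: nx; exists x.
have mhl : measurable_fun setT (fun x : 'rV[R]_n => hi (lambda *: x)%R).
  by apply: measurableT_comp mhi _; exact: measurable_funZ_rV.
have habs : lam.-integrable setT (fun x => (`|dotp x u| * lo x)%:E).
  apply: le_integrable integrable_lin => //.
    by apply/measurable_EFinP; exact: measurable_funM.
  by move=> x _; rewrite !abse_EFin !normrM normr_id.
have pt x : ((`|dotp x u| + dotp x u) * lo x <=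
    28^-1 * lo x + 28^-1 * (dotp x u ^+ 2 * lo x) + 28 * kap * hi (lambda *: x)%R)%R.
  have [xu|fx] := nx x.
    apply: (@le_trans _ _ (28^-1 * lo x)%R).
      apply: ler_wpM2r => //.
      case: (leP 0%R (dotp x u)) => x0; [rewrite ger0_norm//|rewrite ltr0_norm//];
        by lra.
    rewrite -addrA lerDl; apply: addr_ge0.
      by apply: mulr_ge0; [rewrite invr_ge0|rewrite mulr_ge0 ?sqr_ge0].
    by apply: mulr_ge0 => //; rewrite mulr_ge0 ?(ltW kap0).
  have lok : (lo x <= kap * hi (lambda *: x)%R)%R.
    apply: (le_trans (lo_f x)); apply: (le_trans fx).
    by rewrite ler_pM2l.
  apply: (@le_trans _ _ (28^-1 * (dotp x u ^+ 2 * lo x) + 28 * lo x)%R).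
    rewrite mulrA -mulrDl; apply: ler_wpM2r => //.
    have := ler_norm (dotp x u); rewrite -(real_normK (num_real (dotp x u))).
    set a := `|_|%R => pa; have := sqr_ge0 (a - 28)%R; nra.
  rewrite -addrA -[leLHS]add0r lerD// ?mulr_ge0// lerD2l -mulrA.
  by rewrite ler_pM2l.
have := mean_abs_lower_bound; apply/negP; rewrite -leNgt.
rewrite -[leLHS]adde0 -int_lin -integralD//.
apply: (@le_trans _ _ (\int[lam]_x (28^-1%:E * (lo x)%:E +
    28^-1%:E * (dotp x u ^+ 2 * lo x)%:E + (28 * kap)%:E * (hi (lambda *: x)%R)%:E))).
  apply: le_integralT => x.
    rewrite -EFinD lee_fin -mulrDl mulr_ge0//.
    by have := ler_norm (- dotp x u)%R; rewrite normrN; lra.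
  by rewrite -!EFinM -!EFinD lee_fin -mulrDl; exact: pt.
rewrite ge0_integralD//; first last.
- by apply/measurable_EFinP; exact: measurable_funM.
- by move=> x _; rewrite mule_ge0// lee_fin// mulr_ge0// ltW.
- apply/measurable_EFinP; apply: measurable_funD; first exact: measurable_funM.
  by apply: measurable_funM => //; apply: measurable_funM => //; exact: measurable_funX.
- move=> x _; rewrite -!EFinM -EFinD lee_fin.
  by have := mulr_ge0 (sqr_ge0 (dotp x u)) (lo0 x); have := lo0 x; lra.
rewrite integralD//; [|exact: (integrableZl measurableT)|exact: (integrableZl measurableT)].
have -> : \int[lam]_x (28^-1%:E * (lo x)%:E) = 28^-1%:E.
  by rewrite integralZl// int_lo mule1.
have -> : \int[lam]_x (28^-1%:E * (dotp x u ^+ 2 * lo x)%:E) = 28^-1%:E.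
  by rewrite integralZl// int_quad u1 mule1.
rewrite ge0_integralZl//; first last.
- by rewrite lee_fin mulr_ge0// ltW.
- by move=> x _; rewrite lee_fin.
- exact/measurable_EFinP.
rewrite (ge0_integral_scale (g := fun x => (hi x)%:E) lambda0)//; first last.
- exact/measurable_EFinP.
rewrite integral_hi_envelope !mule1 -!EFinM -!EFinD lee_fin.
have : (kap * (lambda ^+ n)^-1 <= kap * K)%R by rewrite ler_pM2l.
by rewrite -[(28 * kap / _)%R]mulrA; move: kapK; lra.
Qed.

End direction.
End isotropic_density.

(** * Absorbing small translations by a dilation *)

Section dilation_constants.
Context {R : realType}.

(** The ratio (n - 1) / n in dimension n = k + 1. *)
Definition dilation k : R := k%:R / k.+1%:R.

Lemma dilation_gt0 k : (0 < k)%N -> 0 < dilation k.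
Proof. by move=> k0; rewrite divr_gt0 ?ltr0n. Qed.

Lemma dilation_jacobian k : (0 < k)%N -> (dilation k ^+ k.+1)^-1 <= expR 2 :> R.
Proof.
move=> k0; have k0' : 0 < k%:R :> R by rewrite ltr0n.
have -> : expR 2 = expR (2 / k.+1%:R) ^+ k.+1 :> R.
  by rewrite -expRM_natl mulrC divfK ?lt0r_neq0// ltr0n.
rewrite -exprVn; apply: lerXn2r.
- by rewrite nnegrE invr_ge0 ltW// dilation_gt0.
- by rewrite nnegrE expR_ge0.
apply: (@le_trans _ _ (1 + k%:R^-1)).
  by rewrite /dilation invf_div -addn1 natrD mulrDl divff ?lt0r_neq0// mul1r.
apply: (@le_trans _ _ (expR (k%:R^-1))); first exact: expR_ge1Dx.
rewrite ler_expR ler_pdivlMr ?ltr0n// mulrC ler_pdivrMr//.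
by rewrite -natrM ler_nat mul2n -addnn -addn1 leq_add2l.
Qed.

(** The factor allowed for f under the dilation by (n - 1) / n.  Its value makes
    decay times the Jacobian bound expR 2 equal to 1 / 784 = 28 ^ -2, which is
    what the moment estimate tolerates. *)
Definition decay : R := (784 * expR 2)^-1.

Lemma decay_gt0 : 0 < decay.
Proof.
rewrite /decay invr_gt0; apply: mulr_gt0; last exact: expR_gt0.
by rewrite ltr0n.
Qed.

End dilation_constants.

Section inner_ball.
Context {R : realType} (k : nat).
Hypothesis k0 : (0 < k)%N.
Local Notation lam := (lebesgue_rV R k.+1).
Variables (f lo hi : 'rV[R]_k.+1 -> R).
Hypothesis lcf : log_concave f.
Hypothesis fmax : forall x, f x <= f 0.
Hypothesis env : borel_envelopes f lo hi.
Hypothesis f_int : (\int[lam]_x (f x)%:E = 1)%E.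
Hypothesis f_iso : isotropic f.

Let f0 x : 0 <= f x. Proof. exact: log_concave_ge0. Qed.

Let root_le (a b c : R) : 0 <= a -> 0 <= b -> 0 <= c ->
  a ^+ k * (c ^+ k.+1 * a) <= b ^+ k.+1 -> c * a <= b.
Proof.
move=> a0 b0 c0 h; rewrite -(@ler_pXn2r _ k.+1)// ?nnegrE ?mulr_ge0//.
apply: le_trans h; rewrite exprMn (exprS a k) le_eqVlt.
by apply/orP; left; apply/eqP; ring.
Qed.

(** If f w < decay^n f 0, separate w from the convex set where
    f >= decay^n f 0.  Every x beyond the separating hyperplane has
    f x < decay^n f 0, and log-concavity on the segment from x to 0 turns this
    into f x <= decay f (dilation x).  When |w| <= 1/56 the hyperplane is too
    close to the origin for that. *)
Lemma isotropic_inner_ball w : dotp w w <= (56^-1) ^+ 2 ->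
  decay ^+ k.+1 * f 0 <= f w.
Proof.
move=> ww; rewrite leNgt; apply/negP => fw.
have [|u u1 uS] := @convex_separation R k.+1 _ w isT
    (@log_concave_superlevel R _ f lcf (decay ^+ k.+1 * f 0)).
  by rewrite /= leNgt fw.
have kK : decay * expR 2 <= 784^-1 :> R.
  by rewrite /decay invfM -mulrA mulVf ?mulr1// gt_eqF ?expR_gt0.
have [x xu fx] := isotropic_deep_halfspace lcf env f_int f_iso u1
  (dilation_gt0 k0) (dilation_jacobian k0) decay_gt0 kK.
apply: fx.
have wu : dotp w u <= 56^-1.
  have [w0|w0] := leP (dotp w u) 0; first by rewrite (le_trans w0)// invr_ge0.
  rewrite -(@ler_pXn2r _ 2)// ?nnegrE ?invr_ge0// ?(ltW w0)//.
  by rewrite (le_trans (dotp_CauchySchwarz w u))// u1 mulr1.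
have {}fx : f x < decay ^+ k.+1 * f 0.
  rewrite ltNge; apply/negP => /uS xw; move: xu.
  by rewrite ltNge (le_trans xw).
have fk := log_concave_exp lcf k x 0.
rewrite addr0 scalerA (mulrC (k.+1%:R)^-1) -/(dilation k) in fk.
rewrite -ler_pdivrMl ?decay_gt0//; apply: root_le => //.
  by rewrite invr_ge0 ltW// decay_gt0.
apply: le_trans fk; apply: ler_wpM2l; first by rewrite exprn_ge0.
by rewrite exprVn ler_pdivrMl ?exprn_gt0 ?decay_gt0// ltW.
Qed.

(** The point dilation x is the combination of x + z, with weight k / (k + 1),
    and of - k z, with weight 1 / (k + 1); the latter lies in the ball of the
    previous lemma.  So translations of length of order 1 / n are absorbed by a
    dilation whose Jacobian is bounded. *)
Lemma isotropic_dilation x z : k%:R ^+ 2 * dotp z z <= (56^-1) ^+ 2 ->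
  decay * f (x + z) <= f (dilation k *: x).
Proof.
move=> zz; pose w := - (k%:R *: z).
have fw : decay ^+ k.+1 * f 0 <= f w.
  apply: isotropic_inner_ball.
  by rewrite /w dotpNl dotpNr opprK dotpZl dotpZr mulrA -expr2.
have fk := log_concave_exp lcf k (x + z) w.
rewrite /w (scalerDr k%:R) addrK scalerA (mulrC (k.+1%:R)^-1) -/(dilation k) in fk.
apply: root_le => //; first by rewrite ltW// decay_gt0.
apply: le_trans fk; apply: ler_wpM2l; first by rewrite exprn_ge0.
apply: le_trans fw; apply: ler_wpM2l => //.
by rewrite exprn_ge0// ltW// decay_gt0.
Qed.

End inner_ball.

(** * Sup-convolution with a segment *)

Section union_of_boxes.
Context {R : realType} (n : nat).

(** The union is open, hence a countable union of boxes with rational centres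
    and radii 1 / (m + 1), although S is arbitrary. *)
Lemma measurable_union_rV_box (S : set 'rV[R]_n) (e : R) :
  measurable [set x | exists2 y, S y & rV_box e (x - y)].
Proof.
set U := [set x | _].
pose C (i : 'rV[rat]_n * nat) := [set x : 'rV[R]_n |
  rV_box (i.2.+1%:R^-1) (x - map_mx ratr i.1)].
have mC i : measurable (C i).
  rewrite (_ : C i = setT `&` (fun x : 'rV[R]_n => x - map_mx ratr i.1) @^-1` rV_box (i.2.+1%:R^-1)).
    by apply: measurable_funD_rV => //; exact: measurable_rV_box.
  by rewrite setTI.
pose D (m : nat) := if unpickle m is Some i then
  (if pselect (C i `<=` U) then C i else set0) else set0.
rewrite (_ : U = \bigcup_m D m).
  apply: bigcupT_measurable => m; rewrite /D.
  case: (unpickle m) => [i|]; last exact: measurable0.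
  by case: pselect => _ //=; exact: measurable0.
apply/seteqP; split=> [x [y Sy xy]|x [m _]]; last first.
  by rewrite /D; case: (unpickle m) => // i; case: pselect => // iU; exact: iU.
have dpos i : 0 < e - `|(x - y) ord0 i| by rewrite subr_gt0.
pose b i := Num.bound (2 / (e - `|(x - y) ord0 i|)).
pose m := \max_i b i.
have m0 : 0 < m.+1%:R^-1 :> R by rewrite invr_gt0 ltr0n.
have mP i : 2 * m.+1%:R^-1 < e - `|(x - y) ord0 i|.
  rewrite ltr_pdivrMr ?ltr0n// mulrC -ltr_pdivrMr//.
  apply: (@lt_le_trans _ _ (b i)%:R).
    by apply: archi_boundP; rewrite divr_ge0// ltW.
  by rewrite ler_nat ltnW// ltnS /m (leq_bigmax i).
have /choice[q qP] : forall i, exists q : rat,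
    ratr q \in `](x ord0 i - m.+1%:R^-1), (x ord0 i + m.+1%:R^-1)[.
  by move=> i; apply: rat_in_itvoo; rewrite ltrBlDr -addrA ltrDl addr_gt0.
pose c : 'rV[rat]_n * nat := (\row_i q i, m).
have qx i : `|x ord0 i - ratr (q i)| < m.+1%:R^-1.
  have := qP i; rewrite in_itv/= => /andP[q1 q2].
  by rewrite ltr_distlC q1 q2.
have cU : C c `<=` U.
  move=> z zc; exists y => // i.
  have := zc i; rewrite !mxE => zq.
  have -> : z ord0 i - y ord0 i = (z ord0 i - ratr (q i)) +
     (- (x ord0 i - ratr (q i)) + (x - y) ord0 i) by rewrite !mxE; ring.
  apply: (le_lt_trans (ler_normD _ _)).
  have := ler_normD (- (x ord0 i - ratr (q i))) ((x - y) ord0 i); rewrite normrN.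
  have := mP i; have := qx i; move: zq; rewrite /c/=; set r := m.+1%:R^-1;
    by move: r => r; lra.
exists (pickle c) => //; rewrite /D pickleK.
by case: pselect => [_ /=|//]; move=> i; rewrite !mxE; exact: qx.
Qed.

End union_of_boxes.

Section sup_translates.
Local Open Scope ereal_scope.
Context {R : realType}.

(** Thickening Z by a small open box costs little and makes the
    sup-convolution of any function f with Z Borel: its strict superlevel sets
    are unions of translates of the box. *)
Definition box_nbhd n (Z : set 'rV[R]_n) (e : R) : set 'rV[R]_n :=
  [set v | exists2 z, Z z & rV_box e (v - z)%R].

(** The sup-convolution of f with the indicator of - W. *)
Definition sup_translates n (f : 'rV[R]_n -> R) (W : set 'rV[R]_n)
    (x : 'rV[R]_n) : \bar R :=
  ereal_sup [set (f (x + v)%R)%:E | v in W].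

Lemma measurable_sup_translates n (f : 'rV[R]_n -> R) Z e :
  measurable_fun setT (sup_translates f (box_nbhd Z e)).
Proof.
apply: (measurability _ (ErealGenOInfty.measurableE R)) => //.
move=> _ [_ [t ->] <-]; rewrite setTI.
rewrite (_ : _ @^-1` _ = [set x | exists2 y,
    (exists2 z, Z z & exists2 v, (t < f v)%R & y = v - z)%R & rV_box e (x - y)%R]).
  exact: measurable_union_rV_box.
apply/seteqP; split=> x /=; rewrite in_itv/= andbT.
  move=> /ereal_sup_gt[_ [v [z Zz zv] <-]]; rewrite lte_fin => tf.
  exists (x + v - z)%R; first by exists z => //; exists (x + v)%R.
  move=> i; have := zv i; rewrite -normrN; congr (`|_| < _)%R.
  by rewrite !mxE; ring.
move=> [_ [z Zz [v tv ->]] xz].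
apply: (@lt_le_trans _ _ (f v)%:E); first by rewrite lte_fin.
apply: ereal_sup_ubound; exists (v - x)%R; last by rewrite addrCA subrr addr0.
exists z => // i; have := xz i; rewrite -normrN; congr (`|_| < _)%R.
by rewrite !mxE; ring.
Qed.

Lemma sup_translates_ge0 n (f : 'rV[R]_n -> R) W x :
  (forall y, (0 <= f y)%R) -> W !=set0 -> 0 <= sup_translates f W x.
Proof.
move=> f0 [w Ww]; apply: (@le_trans _ _ (f (x + w)%R)%:E).
  by rewrite lee_fin.
by apply: ereal_sup_ubound; exists w.
Qed.

Lemma box_nbhd_self n (Z : set 'rV[R]_n) (e : R) z : (0 < e)%R -> Z z ->
  box_nbhd Z e z.
Proof. by move=> e0 Zz; exists z => // i; rewrite subrr mxE normr0. Qed.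

End sup_translates.

Section segment_sum.
Local Open Scope ereal_scope.
Context {R : realType}.
Local Notation leb := (@lebesgue_measure R).

(** On a line: cut the graph of g at s0, move the two halves apart by d on each
    side, and fill the gap of length 2 d with the value g s0.  The result is
    still below G, which dominates g on windows of half-length d. *)
Let integral_dilate_sup (g G : R -> \bar R) (d s0 : R) : (0 <= d)%R ->
  measurable_fun setT g -> measurable_fun setT G -> (forall s, 0 <= g s) ->
  (forall s t, (`|t| <= d)%R -> g (s + t)%R <= G s) ->
  \int[leb]_s g s + (2 * d)%:E * g s0 <= \int[leb]_s G s.
Proof.
move=> d0 mg mG g0 gG.
have ind0 (A : set R) x : 0 <= (\1_A x)%:E :> \bar R by rewrite lee_fin.
have G0 s : 0 <= G s.
  by apply: le_trans (gG s 0%R _); rewrite ?normr0.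
pose I1 := (`]-oo, s0[%classic : set R); pose I2 := (`[s0, +oo[%classic : set R).
pose J := (`[(s0 - d)%R, (s0 + d)%R[%classic : set R).
have mi A : measurable A -> measurable_fun setT (fun s : R => (\1_A s)%:E : \bar R).
  by move=> mA; exact/measurable_EFinP/measurable_indic.
have mI1 : measurable I1 by exact: measurable_itv.
have mI2 : measurable I2 by exact: measurable_itv.
have mJ : measurable J by exact: measurable_itv.
have I1E s : (s \in I1) = (s < s0)%R.
  by apply/idP/idP; rewrite inE /I1/= in_itv.
have I2E s : (s \in I2) = (s0 <= s)%R.
  by apply/idP/idP; rewrite inE /I2/= in_itv/= andbT.
have JE s : (s \in J) = (s0 - d <= s < s0 + d)%R.
  by apply/idP/idP; rewrite inE /J/= in_itv.
pose g1 s := g s * (\1_I1 s)%:E; pose g2 s := g s * (\1_I2 s)%:E.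
have mg1 : measurable_fun setT g1 by apply: emeasurable_funM => //; exact: mi.
have mg2 : measurable_fun setT g2 by apply: emeasurable_funM => //; exact: mi.
have g10 s : 0 <= g1 s by exact: mule_ge0.
have g20 s : 0 <= g2 s by exact: mule_ge0.
have msh (h : R -> \bar R) (c : R) : measurable_fun setT h ->
    measurable_fun setT (fun s : R => h (s + c)%R).
  by move=> mh; apply: measurableT_comp mh _; exact: measurable_funD.
have -> : \int[leb]_s g s = \int[leb]_s g1 (s + d)%R + \int[leb]_s g2 (s + - d)%R.
  rewrite !ge0_integral_translation// -ge0_integralD//.
  apply: eq_integral => s _; rewrite /g1 /g2 !indicE I1E I2E.
  by case: ltP => _ /=; rewrite ?mule1 ?mule0 ?adde0 ?add0e.
have -> : (2 * d)%:E * g s0 = \int[leb]_s (g s0 * (\1_J s)%:E).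
  rewrite ge0_integralZl//; last exact: mi.
  have JL : leb J = (2 * d)%:E.
    rewrite lebesgue_measure_itv/= lte_fin.
    case: ltP => dd; first by rewrite -EFinB; congr _%:E; ring.
    by congr _%:E; lra.
  by rewrite integral_indic// setIT muleC; congr (_ * _); exact: esym JL.
have mcJ : measurable_fun setT (fun s => g s0 * (\1_J s)%:E).
  by apply: measurable_funeM; exact: mi.
rewrite -addeA -!ge0_integralD//; try by
  [exact: msh|move=> s _; rewrite ?adde_ge0// mule_ge0
  |apply: emeasurable_funD => //; exact: msh].
apply: le_integralT => s; first by rewrite !adde_ge0// mule_ge0.
rewrite /g1 /g2 !indicE I1E I2E JE.
have [s1|s1] := ltP s (s0 - d)%R.
  have a1 : (s + d < s0)%R by lra.
  have a2 : (s0 <= s - d)%R = false by apply/negbTE; rewrite -ltNge; lra.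
  have a3 : (s0 - d <= s)%R = false by apply/negbTE; rewrite -ltNge.
  rewrite a1 a2 /= !mule0 mule1 !adde0.
  by apply: gG; rewrite ger0_norm.
have a1 : (s + d < s0)%R = false by apply/negbTE; rewrite -leNgt; lra.
have [s2|s2] := ltP s (s0 + d)%R.
  have a2 : (s0 <= s - d)%R = false by apply/negbTE; rewrite -ltNge; lra.
  rewrite a1 a2/= !mule0 mule1 add0e add0e -(subrKC s s0).
  by apply: gG; rewrite ler_norml; apply/andP; split; lra.
have a2 : (s0 <= s - d)%R by lra.
rewrite a1 a2 /= !mule0 mule1 adde0 add0e.
by apply: gG; rewrite normrN ger0_norm.
Qed.

Let integral_frame (k : nat) (th : 'rV[R]_(1 + k)) (B : 'M[R]_(k, 1 + k))
    (g : 'rV[R]_(1 + k) -> \bar R) :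
  dotp th th = 1%R -> B *m B^T = 1%:M -> th *m B^T = 0%R ->
  measurable_fun setT g -> (forall x, 0 <= g x) ->
  \int[lebesgue_rV R (1 + k)]_x g x =
  \int[lebesgue_rV R k]_v \int[leb]_s g (v *m B + s *: th)%R.
Proof.
move=> t1 BB tB mg g0.
rewrite -(ge0_integral_orthogonal (col_mx_orthonormal t1 BB tB))//.
rewrite ge0_integral_rV_cons_swap//; last exact: measurableT_comp mg (measurable_mulmx_rV _).
apply: eq_integral => v _; apply: eq_integral => s _; congr g.
rewrite /rV_cons mul_row_col addrC; congr (_ + _)%R.
by apply/rowP => j; rewrite !mxE big_ord1 !mxE.
Qed.

(** Fubini in the orthonormal frame (th, B) reduces this to the lines directed by
    th.  On each of them the one-dimensional fact gives a gain of 2 d times the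
    value at s0; letting s0 run over the line, 2 d times the supremum. *)
Lemma sup_translates_segment m n (th : 'rV[R]_n) (B : 'M[R]_(m, n))
    (f : 'rV[R]_n -> R) (Z : set 'rV[R]_n) (e d : R) :
  (1 + m)%N = n -> dotp th th = 1%R -> B *m B^T = 1%:M -> th *m B^T = 0%R ->
  (forall x, 0 <= f x)%R -> Z !=set0 -> (0 < e)%R -> (0 < d)%R ->
  \int[lebesgue_rV R n]_x sup_translates f (box_nbhd Z e) x +
  (2 * d)%:E * \int[lebesgue_rV R m]_v
     sup_translates f (box_nbhd [set z + s *: th | z in Z & s in setT]%R e) (v *m B)
  <= \int[lebesgue_rV R n]_x
     sup_translates f (box_nbhd [set z + s *: th | z in Z & s in `[(- d)%R, d]]%R e) x.
Proof.
move=> mn; case: n / mn th B f Z => th B f Z t1 BB tB f0 [z0 Zz0] e0 d0.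
have mS Z' : measurable_fun setT (sup_translates f (box_nbhd Z' e)).
  exact: measurable_sup_translates.
pose Zd : set 'rV[R]_(1 + m) :=
  [set z + s *: th | z in Z & s in `[(- d)%R, d]]%R.
pose Zl : set 'rV[R]_(1 + m) := [set z + s *: th | z in Z & s in setT]%R.
rewrite -/Zd -/Zl.
have S0 Z' x : Z' !=set0 -> 0 <= sup_translates f (box_nbhd Z' e) x.
  by move=> [z Z'z]; apply: sup_translates_ge0 => //; exists z; exact: box_nbhd_self.
have Z0 : Z !=set0 by exists z0.
have Zd0 : Zd !=set0.
  by exists (z0 + 0 *: th)%R; exists z0 => //; exists 0%R => //=; rewrite in_itv/= oppr_le0 !ltW.
have Zl0 : Zl !=set0 by exists (z0 + 0 *: th)%R; exists z0 => //; exists 0%R.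
have mline Z' v : measurable_fun setT
    (fun s : R => sup_translates f (box_nbhd Z' e) (v *m B + s *: th)%R).
  by apply: measurableT_comp (mS Z') _; apply: measurable_funD_rV => //;
     exact: measurable_funZ_rV.
have mpair Z' : measurable_fun setT (fun p : R * 'rV[R]_m =>
    sup_translates f (box_nbhd Z' e) (p.2 *m B + p.1 *: th)%R).
  apply: measurableT_comp (mS Z') _; apply: measurable_funD_rV.
    by apply: measurable_funM_rV.
  exact: measurable_funZ_rV.
have mslice Z' : Z' !=set0 -> measurable_fun setT (fun v : 'rV[R]_m =>
    \int[leb]_s sup_translates f (box_nbhd Z' e) (v *m B + s *: th)%R).
  move=> Z'0; apply: (measurable_fun_fubini_tonelli_G (fun p : measurableTypeR R * 'rV[R]_m =>
    sup_translates f (box_nbhd Z' e) (p.2 *m B + p.1 *: th)%R)); first exact: mpair.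
  by move=> p; exact: S0.
rewrite !(integral_frame t1 BB tB)//; try by move=> x; exact: S0.
have mP : measurable_fun setT (fun v => sup_translates f (box_nbhd Zl e) (v *m B)).
  by apply: measurableT_comp (mS Zl) _; exact: measurable_mulmx_rV.
rewrite -ge0_integralZl//; first last.
- by rewrite lee_fin mulr_ge0// ltW.
- by move=> v _; exact: S0.
rewrite -ge0_integralD//; first last.
- exact: measurable_funeM.
- by move=> v _; rewrite mule_ge0 ?lee_fin ?mulr_ge0 ?(ltW d0)//; exact: S0.
- exact: mslice.
- by move=> v _; apply: integral_ge0 => s _; exact: S0.
apply: le_integralT => v.
  rewrite adde_ge0// ?mule_ge0 ?lee_fin ?mulr_ge0 ?(ltW d0)//; last exact: S0.
  by apply: integral_ge0 => s _; exact: S0.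
set I := integral _ _ _; set J := integral _ _ _.
have key s0 : I + (2 * d)%:E * sup_translates f (box_nbhd Z e) (v *m B + s0 *: th)%R <= J.
  apply: (@integral_dilate_sup
    (fun s => sup_translates f (box_nbhd Z e) (v *m B + s *: th)%R)) => //.
  - exact: ltW.
  - by move=> s; exact: S0.
  move=> s t td; apply: ge_ereal_sup => _ [w [z Zz wz] <-].
  apply: ereal_sup_ubound; exists (w + t *: th)%R; last first.
    by congr (f _)%:E; rewrite scalerDl addrA -!addrA; congr (_ + (_ + _))%R; rewrite addrC.
  exists (z + t *: th)%R.
    by exists z => //; exists t => //=; rewrite in_itv/= -ler_norml.
  by rewrite opprD addrACA subrr addr0.
have I0 : 0 <= I by apply: integral_ge0 => s _; exact: S0.
have [JE|JNoo] := eqVneq J +oo; first by rewrite JE leey.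
have If : I \is a fin_num.
  rewrite ge0_fin_numE//; apply: (@le_lt_trans _ _ J); last by rewrite ltey.
  by apply: le_trans (key 0%R); rewrite leeDl// mule_ge0 ?lee_fin ?mulr_ge0 ?(ltW d0)//; exact: S0.
have d2 : (0 < 2 * d)%R by exact: mulr_gt0.
rewrite addeC -leeBrDr// muleC -lee_pdivlMr//; apply: ge_ereal_sup => _ [w [_ [z Zz [s _ <-]] wz] <-].
rewrite lee_pdivlMr// leeBrDr// addeC muleC; apply: le_trans (key s).
apply: leeD2l; apply: lee_wpmul2l; first by rewrite lee_fin ltW.
apply: ereal_sup_ubound; exists (w - s *: th)%R; last first.
  by congr (f _)%:E; rewrite -addrA [(s *: th + _)%R]addrC subrK.
by exists z => //; rewrite -addrA -opprD [(s *: th + z)%R]addrC.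
Qed.

End segment_sum.

(** * Projections along normals and zonotopes *)

Section orthonormal_bases.
Context {R : realType}.

Lemma orthonormal_decomposition m n (B : 'M[R]_(m, n)) (th y : 'rV[R]_n) :
  (1 + m)%N = n -> dotp th th = 1 -> B *m B^T = 1%:M -> th *m B^T = 0 ->
  y = dotp y th *: th + y *m B^T *m B.
Proof.
move=> mn; case: n / mn B th y => B th y t1 BB tB.
have := mulmx1C (col_mx_orthonormal t1 BB tB).
rewrite tr_col_mx mul_row_col => /(congr1 (mulmx y)).
rewrite mulmx1 mulmxDr !mulmxA => {1}<-; congr (_ + _).
by rewrite [y *m _]mx11_scalar mul_scalar_mx.
Qed.

Lemma gram_schmidt m n (A : 'M[R]_(m, n)) : row_free A ->
  exists2 B : 'M[R]_(m, n), B *m B^T = 1%:M & (B :=: A)%MS.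
Proof.
elim: m A => [|m IH] A fA.
  by exists A => //; apply/matrixP => -[].
pose a : 'rV[R]_n := @usubmx R 1 m n A; pose A' : 'M[R]_(m, n) := @dsubmx R 1 m n A.
have AE : A = col_mx a A' by rewrite vsubmxK.
have inj (u : 'rV[R]_(1 + m)) : u *m col_mx a A' = 0 -> u = 0.
  by rewrite -AE => uA; apply: (row_free_inj fA); rewrite uA mul0mx.
have [] := IH A'.
  apply: inj_row_free => v vA.
  have : row_mx 0 v = 0 :> 'rV[R]_(1 + m).
    by apply: inj; rewrite mul_row_col mul0mx vA addr0.
  by move=> /(congr1 rsubmx); rewrite row_mxKr linear0.
move=> B' BB eB.
pose a' := a - a *m B'^T *m B'.
have aB : a' *m B'^T = 0.
  by rewrite mulmxBl -[a *m _ *m _ *m _]mulmxA BB mulmx1 subrr.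
have a'0 : a' != 0.
  apply/eqP => /eqP; rewrite subr_eq0 => /eqP a_eq.
  have /submxP[v av] : (a <= A')%MS by rewrite -eB a_eq submxMl.
  have : row_mx 1%:M (- v) = 0 :> 'rV[R]_(1 + m).
    by apply: inj; rewrite mul_row_col mul1mx mulNmx -av subrr.
  move=> /(congr1 lsubmx); rewrite row_mxKl linear0 => /matrixP/(_ ord0 ord0).
  by rewrite !mxE eqxx => /eqP; rewrite oner_eq0.
set r := Num.sqrt (dotp a' a').
have r0 : r != 0 by rewrite gt_eqF// sqrtr_gt0 dotp_gt0.
pose b := r^-1 *: a'.
have b1 : dotp b b = 1 by exact: normalize_dotp.
have bB : b *m B'^T = 0 by rewrite -scalemxAl aB scaler0.
exists (col_mx b B'); first exact: col_mx_orthonormal.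
have sB : (B' <= col_mx a A')%MS by rewrite eB -addsmxE addsmxSr.
have sA : (A' <= col_mx b B')%MS by rewrite -eB -addsmxE addsmxSr.
have s1 : (col_mx b B' <= col_mx a A')%MS.
  rewrite col_mx_sub sB andbT scalemx_sub// addmx_sub//; first by rewrite -addsmxE addsmxSl.
  by rewrite -mulNmx (submx_trans _ sB)// submxMl.
have s2 : (col_mx a A' <= col_mx b B')%MS.
  rewrite col_mx_sub sA andbT -[a](subrK (a *m B'^T *m B')) -/a' addmx_sub//.
    rewrite (_ : a' = r *: b); last by rewrite scalerA divff// scale1r.
    by rewrite scalemx_sub// -addsmxE addsmxSl.
  by rewrite (submx_trans (submxMl _ _))// -addsmxE addsmxSr.
by apply/eqmxP/andP; split; rewrite AE; [exact: s1|exact: s2].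
Qed.

Lemma onbP n (E : {vspace 'rV[R]_n}) : is_orthonormal_basis (onb E).
Proof.
apply: getPex.
pose A : 'M[R]_(\dim E, n) := \matrix_(i < \dim E) (vbasis E)`_i.
have fA : row_free A.
  apply: inj_row_free => v; rewrite mulmx_sum_row => v0.
  have /freeP := basis_free (vbasisP E) => /(_ (fun i => v ord0 i)) h.
  apply/rowP => i; rewrite mxE; apply: h; rewrite -[RHS]v0.
  by apply: eq_bigr => j _; rewrite rowK.
have [B BB eB] := gram_schmidt fA.
exists B; split=> // x; rewrite eB; apply/idP/idP.
  move=> /coord_vbasis xE; apply/submxP.
  exists (\row_i coord (vbasis E) i x); rewrite mulmx_sum_row {1}xE.
  by apply: eq_bigr => i _; rewrite rowK mxE.
move=> /submxP[v ->]; rewrite mulmx_sum_row memv_suml// => i _.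
by rewrite rowK memvZ// vbasis_mem// mem_nth// size_tuple.
Qed.

Lemma onb_orthonormal n (E : {vspace 'rV[R]_n}) : onb E *m (onb E)^T = 1%:M.
Proof. by case: (onbP E). Qed.

Lemma mem_onb n (E : {vspace 'rV[R]_n}) x : (x \in E) = (x <= onb E)%MS.
Proof. by case: (onbP E). Qed.

Definition unit_normal n (E : {vspace 'rV[R]_n}) (th : 'rV[R]_n) : Prop :=
  dotp th th = 1 /\ forall x, x \in E -> dotp x th = 0.

Lemma orthocomp_onb n (E : {vspace 'rV[R]_n}) y :
  (forall x, x \in E -> dotp x y = 0) -> y *m (onb E)^T = 0.
Proof.
move=> yE; apply/rowP => i; rewrite [RHS]mxE -[RHS](yE (row i (onb E))).
  by rewrite dotpC dotpE mxE; apply: eq_bigr => j _; rewrite !mxE.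
by rewrite mem_onb row_sub.
Qed.

Lemma unit_normal_exists n (E : {vspace 'rV[R]_n}) : (\dim E < n)%N ->
  exists th, unit_normal E th.
Proof.
move=> En.
have /rowV0Pn[v /sub_kermxP vB v0] : kermx (onb E)^T != 0.
  rewrite -mxrank_eq0 mxrank_ker mxrank_tr -lt0n subn_gt0.
  exact: leq_ltn_trans (rank_leq_row _) En.
exists ((Num.sqrt (dotp v v))^-1 *: v); split; first exact: normalize_dotp.
move=> x; rewrite mem_onb => /submxP[w ->].
rewrite dotpZr dotp_mulmx.
by rewrite vB dotp0r mulr0.
Qed.

Lemma orthocomp_line n (E : {vspace 'rV[R]_n}) th y : (1 + \dim E)%N = n ->
  unit_normal E th -> orthocomp E y -> y = dotp y th *: th.
Proof.
move=> En [t1 tE] yE.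
rewrite {1}(orthonormal_decomposition y En t1 (onb_orthonormal E)).
  by rewrite (orthocomp_onb yE) mul0mx addr0.
exact: orthocomp_onb.
Qed.

End orthonormal_bases.

Section projections_along_normals.
Local Open Scope ereal_scope.
Context {R : realType} (n : nat).
Variables (f : 'rV[R]_n -> R) (e d : R).
Hypothesis f0 : forall x, (0 <= f x)%R.
Hypotheses (e0 : (0 < e)%R) (d0 : (0 < d)%R).

Let proj_norm1_le (E : {vspace 'rV[R]_n}) th (Z : set 'rV[R]_n) :
  (1 + \dim E)%N = n -> unit_normal E th -> Z 0%R ->
  proj_norm1 E f <= \int[lebesgue_rV R (\dim E)]_v
    sup_translates f (box_nbhd [set z + s *: th | z in Z & s in setT]%R e) (v *m onb E).
Proof.
move=> En nE Z0; set Zl : set 'rV[R]_n := [set _ | _ in Z & _ in _].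
have Zl0 : Zl 0%R by exists 0%R => //; exists 0%R => //; rewrite scale0r addr0.
have S0 x : 0 <= sup_translates f (box_nbhd Zl e) x.
  by apply: sup_translates_ge0 => //; exists 0%R; exact: box_nbhd_self.
rewrite -(ge0_integral_pushforward (measurable_mulmx_rV (onb E)) _ (D := setT)
  (f := sup_translates f (box_nbhd Zl e)))//; last exact: measurable_sup_translates.
rewrite /proj_norm1 integral_mkcond; apply: le_integralT => x.
  by rewrite erestrict_ge0.
rewrite patchE; case: ifPn => // _.
rewrite gee0_abs.
  apply: ge_ereal_sup => _ [y yE <-]; apply: ereal_sup_ubound; exists y => //.
  apply: box_nbhd_self => //; exists 0%R => //; exists (dotp y th) => //.
  by rewrite add0r -(orthocomp_line En nE yE).
apply: (@le_trans _ _ (f (x + 0))%:E); first by rewrite lee_fin.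
by apply: ereal_sup_ubound; exists 0%R => // y _; rewrite dotp0r.
Qed.

(** A zonotope.  Its generators, the second components, come with the hyperplanes
    to which they are normal, as the induction on l deals with both. *)
Fixpoint segment_sum (l : seq ({vspace 'rV[R]_n} * 'rV[R]_n)) : set 'rV[R]_n :=
  if l is p :: l' then
    [set z + s *: p.2 | z in segment_sum l' & s in `[(- d)%R, d]]%R
  else [set 0%R].

Lemma segment_sum0 l : segment_sum l 0%R.
Proof.
elim: l => [|p l IH] //=; exists 0%R => //; exists 0%R.
  by rewrite /= in_itv/= oppr_le0 !ltW.
by rewrite scale0r addr0.
Qed.

(** With y = z this bounds the norm of the points of the zonotope. *)
Lemma segment_sum_dotp l z y : segment_sum l z ->
  (dotp z y <= d * \sum_(p <- l) `|dotp p.2 y|)%R.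
Proof.
elim: l z => [|p l IH] z /=; first by move=> ->; rewrite dotp0l big_nil mulr0.
move=> [w lw [s sd <-]]; rewrite big_cons mulrDr dotpDl addrC.
apply: lerD; last exact: IH.
rewrite dotpZl; apply: (le_trans (ler_norm _)); rewrite normrM.
by apply: ler_wpM2r => //; rewrite ler_norml; move: sd; rewrite /= in_itv.
Qed.

(** The segments are added one at a time.  Each addition brings at least 2 d
    times the integral of the projection of f, because the zonotope built so far
    contains the origin. *)
Lemma sum_proj_norm1_le (l : seq ({vspace 'rV[R]_n} * 'rV[R]_n)) :
  (forall p, p \in l -> (1 + \dim p.1)%N = n /\ unit_normal p.1 p.2) ->
  (2 * d)%:E * \sum_(p <- l) proj_norm1 p.1 f <=
  \int[lebesgue_rV R n]_x sup_translates f (box_nbhd (segment_sum l) e) x.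
Proof.
have pn0 E : 0 <= proj_norm1 E f by apply: integral_ge0.
elim: l => [|p l IH] lP.
  rewrite big_nil mule0; apply: integral_ge0 => x _; apply: sup_translates_ge0 => //.
  by exists 0%R; exact: box_nbhd_self.
have [pn [p1 pE]] := lP p (mem_head _ _).
have pB := orthocomp_onb pE.
have l0 : segment_sum l !=set0 by exists 0%R; exact: segment_sum0.
have := sup_translates_segment pn p1 (onb_orthonormal _) pB f0 l0 e0 d0.
apply: le_trans; rewrite big_cons ge0_muleDr//; last by apply: sume_ge0.
rewrite addeC; apply: leeD; last by apply: IH => q ql; apply: lP; rewrite inE ql orbT.
apply: lee_wpmul2l; first by rewrite lee_fin mulr_ge0// ltW.
by apply: proj_norm1_le => //; exact: segment_sum0.
Qed.

End projections_along_normals.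

(** * Rotations of the cube *)

Section signed_rotations.
Context {R : realType} (n : nat).
Implicit Types U : 'M[R]_n.

Definition sign_entries U : bool := [forall i, forall j, U i j \in [:: -1; 0; 1]].

Definition rotationb U : bool := (U *m U^T == 1%:M) && (\det U == 1).

(** The rotation group of the cube.  Averages over this finite group replace
    averages over all rotations. *)
Definition signed_rotations : seq 'M[R]_n :=
  undup [seq U <- [seq \matrix_(i, j) ((g (i, j) : 'I_3)%:R - 1) |
                   g : {ffun 'I_n * 'I_n -> 'I_3}] | rotationb U].

Lemma mem_signed_rotations U :
  (U \in signed_rotations) = rotationb U && sign_entries U.
Proof.
rewrite mem_undup mem_filter; congr (_ && _); apply/mapP/idP.
  move=> [g _ ->]; apply/forallP => i; apply/forallP => j; rewrite mxE !inE.
  case: (g (i, j)) => -[|[|[|//]]] /= _.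
  - by rewrite sub0r eqxx.
  - by rewrite subrr eqxx orbT.
  - by rewrite (_ : 2 - 1 = 1 :> R) ?eqxx ?orbT//; ring.
move=> /forallP UP.
pose g : {ffun 'I_n * 'I_n -> 'I_3} := [ffun p =>
  if U p.1 p.2 == -1 then 0 else if U p.1 p.2 == 0 then 1 else ord_max].
exists g; first by rewrite mem_enum.
apply/matrixP => i j; rewrite mxE ffunE /=.
have := forallP (UP i) j; rewrite !inE.
have [->|_] := eqVneq (U i j) (-1); first by rewrite sub0r.
have [->|_] := eqVneq (U i j) 0; first by rewrite subrr.
by move=> /= /eqP ->; rewrite /=; ring.
Qed.

Lemma signed_rotations_rotation U : U \in signed_rotations -> is_rotation U.
Proof. by rewrite mem_signed_rotations => /andP[/andP[/eqP ? /eqP ?] _]. Qed.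

Lemma size_signed_rotations_gt0 : (0 < size signed_rotations)%N.
Proof.
have : 1%:M \in signed_rotations.
  rewrite mem_signed_rotations /rotationb trmx1 mulmx1 det1 !eqxx/=.
  apply/forallP => i; apply/forallP => j; rewrite mxE.
  by case: (i == j); rewrite !inE eqxx ?orbT.
by case: signed_rotations.
Qed.

Let quarter_diag (i : 'I_n) : 'rV[R]_n := \row_k (if k == i then -1 else 1).

(** The rotation by a right angle in the plane of the coordinates i and j. *)
Definition quarter_turn (i j : 'I_n) : 'M[R]_n :=
  perm_mx (tperm i j) *m diag_mx (quarter_diag i).

Let delta_quarter_turn i j a :
  delta_mx (ord0 : 'I_1) a *m quarter_turn i j =
  quarter_diag i ord0 (tperm i j a) *: delta_mx (ord0 : 'I_1) (tperm i j a).
Proof.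
rewrite -rowE; apply/rowP => b; rewrite /quarter_turn mul_mx_diag !mxE eqxx/=.
by rewrite eq_sym; case: eqVneq => [->|_]; rewrite ?mul1r ?mul0r ?mulr1 ?mulr0.
Qed.

Lemma quarter_turn_l i j : i != j ->
  delta_mx (ord0 : 'I_1) i *m quarter_turn i j = delta_mx (ord0 : 'I_1) j.
Proof.
by move=> ij; rewrite delta_quarter_turn tpermL mxE eq_sym (negbTE ij) scale1r.
Qed.

Lemma quarter_turn_r i j : delta_mx (ord0 : 'I_1) j *m quarter_turn i j = - delta_mx (ord0 : 'I_1) i.
Proof. by rewrite delta_quarter_turn tpermR mxE eqxx scaleN1r. Qed.

Let quarter_diag_sqr i : diag_mx (quarter_diag i) *m diag_mx (quarter_diag i) = 1%:M.
Proof.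
rewrite mul_mx_diag; apply/matrixP => a b; rewrite !mxE.
have [->|_] := eqVneq a b; last by rewrite mulr0n mul0r.
by rewrite mulr1n; case: ifP => _; rewrite ?mulrNN mulr1.
Qed.

Lemma quarter_turn_orthogonal i j : quarter_turn i j *m (quarter_turn i j)^T = 1%:M.
Proof.
rewrite /quarter_turn trmx_mul tr_diag_mx mulmxA -[_ *m diag_mx _ *m diag_mx _]mulmxA.
by rewrite quarter_diag_sqr mulmx1 tr_perm_mx -perm_mxM mulgV perm_mx1.
Qed.

Lemma det_quarter_turn i j : i != j -> \det (quarter_turn i j) = 1.
Proof.
move=> ij; rewrite /quarter_turn det_mulmx det_perm odd_tperm ij expr1 det_diag.
rewrite (bigD1 i)//= mxE eqxx big1 ?mulr1 ?mulrNN ?mulr1// => k ki.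
by rewrite mxE (negbTE ki).
Qed.

Let signed_rotations_mulT i j U : i != j -> U \in signed_rotations ->
  U *m (quarter_turn i j)^T \in signed_rotations.
Proof.
move=> ij; rewrite !mem_signed_rotations => /andP[/andP[/eqP UU /eqP dU] eU].
apply/andP; split.
  rewrite /rotationb (trmx_mul U) trmxK mulmxA -[U *m _ *m _]mulmxA.
  rewrite (mulmx1C (quarter_turn_orthogonal i j)) mulmx1 UU eqxx/=.
  by rewrite det_mulmx det_tr det_quarter_turn// mulr1 dU.
apply/forallP => a; apply/forallP => b.
rewrite /quarter_turn trmx_mul tr_diag_mx tr_perm_mx mulmxA -col_permE mul_mx_diag !mxE.
have /forallP/(_ a)/forallP/(_ (tperm i j b)) := eU; rewrite !inE.
case: ifP => _; rewrite ?mulr1// mulrN1.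
by move=> /or3P[] /eqP ->; rewrite ?opprK ?oppr0 eqxx ?orbT.
Qed.

(** The orbit of any unit vector under the rotations of the cube is a tight
    frame.  The form b (x, y), the sum over U of <x, th U> <y, th U>, is
    invariant under quarter turns, hence vanishes on pairs of distinct basis
    vectors and takes the same value at all basis vectors; the trace gives this
    value. *)
Lemma signed_rotations_frame (th z : 'rV[R]_n) : dotp th th = 1 ->
  n%:R * \sum_(U <- signed_rotations) dotp z (th *m U) ^+ 2 =
  (size signed_rotations)%:R * dotp z z.
Proof.
move=> t1.
pose b (x y : 'rV[R]_n) := \sum_(U <- signed_rotations) dotp x (th *m U) * dotp y (th *m U).
pose e (a : 'I_n) : 'rV[R]_n := delta_mx (ord0 : 'I_1) a.
have bT x y i j : i != j -> b (x *m quarter_turn i j) (y *m quarter_turn i j) = b x y.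
  move=> ij; pose T := quarter_turn i j.
  have pS : perm_eq signed_rotations [seq U *m T^T | U <- signed_rotations].
    have inj : injective (fun U => U *m T^T).
      move=> U V /(congr1 (fun W => W *m T)).
      by rewrite -!mulmxA (mulmx1C (quarter_turn_orthogonal i j)) !mulmx1.
    have um : uniq [seq U *m T^T | U <- signed_rotations].
      by rewrite map_inj_uniq// undup_uniq.
    rewrite perm_sym; apply: uniq_perm => //; first exact: undup_uniq.
    apply: (uniq_min_size um _ _).2; last by rewrite size_map.
    by move=> _ /mapP[U US ->]; exact: signed_rotations_mulT.
  rewrite [RHS](perm_big _ pS)/= big_map; apply: eq_bigr => U _.
  by rewrite !dotp_mulmx mulmxA.
have boff i j : i != j -> b (e i) (e j) = 0.
  move=> ij; have := bT (e i) (e j) i j ij; rewrite quarter_turn_l// quarter_turn_r.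
  have -> : b (e j) (- e i) = - b (e i) (e j).
    by rewrite /b -sumrN; apply: eq_bigr => U _; rewrite dotpNl mulrN mulrC.
  by move=> h; lra.
have bdiag i j : b (e i) (e i) = b (e j) (e j).
  have [->//|ij] := eqVneq i j.
  by rewrite -(bT (e i) (e i) i j ij) quarter_turn_l.
have eE x a : dotp (e a) x = x ord0 a.
  rewrite dotpE (bigD1 a)//= mxE !eqxx mul1r big1 ?addr0// => c ca.
  by rewrite mxE eqxx (negbTE ca) mul0r.
have trace a : n%:R * b (e a) (e a) = (size signed_rotations)%:R.
  rewrite mulr_natl -[X in _ *+ X](card_ord n) -sumr_const.
  rewrite (eq_bigr (fun c => b (e c) (e c))); last by move=> c _; exact: bdiag.
  rewrite exchange_big/= (eq_big_seq (fun=> 1)).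
    by rewrite big_const_seq count_predT iter_addr_0.
  move=> U /signed_rotations_rotation[UU _].
  under eq_bigr do rewrite !eE.
  by rewrite -dotpE dotp_mulmx -mulmxA UU mulmx1.
have -> : \sum_(U <- signed_rotations) dotp z (th *m U) ^+ 2 =
    \sum_a \sum_c z ord0 a * z ord0 c * b (e a) (e c).
  under [RHS]eq_bigr do under eq_bigr do rewrite mulr_sumr.
  under [RHS]eq_bigr do rewrite exchange_big.
  rewrite exchange_big/=; apply: eq_bigr => U _.
  rewrite expr2 {1}dotpE mulr_suml; apply: eq_bigr => a _.
  rewrite dotpE mulr_sumr; apply: eq_bigr => c _; rewrite !eE; ring.
rewrite mulr_sumr dotpE mulr_sumr; apply: eq_bigr => a _.
rewrite (bigD1 a)//= big1 ?addr0; last first.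
  by move=> c ca; rewrite boff ?mulr0// eq_sym.
by rewrite mulrCA trace mulrC.
Qed.

End signed_rotations.

(** * Averaging over hyperplanes *)

Section rotated_hyperplanes.
Context {R : realType} (n : nat).
Implicit Types (U : 'M[R]_n) (E : {vspace 'rV[R]_n}).

Definition rotate U E : {vspace 'rV[R]_n} := (linfun (mulmxr U) @: E)%VS.

Lemma is_rotation_tr U : is_rotation U -> is_rotation U^T.
Proof.
by move=> [UU dU]; split; [rewrite trmxK; exact: mulmx1C|rewrite det_tr].
Qed.

Lemma mem_rotate U E x : is_rotation U -> (x \in rotate U E) = (x *m U^T \in E).
Proof.
move=> [UU _]; apply/memv_imgP/idP => [[y yE ->]|xE].
  by rewrite lfunE/= -mulmxA UU mulmx1.
by exists (x *m U^T) => //; rewrite lfunE/= -mulmxA (mulmx1C UU) mulmx1.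
Qed.

Lemma rotateK U E : is_rotation U -> rotate U^T (rotate U E) = E.
Proof.
move=> rU; apply/vspaceP => x; rewrite mem_rotate; last exact: is_rotation_tr.
by rewrite mem_rotate// trmxK -mulmxA; case: rU => -> _; rewrite mulmx1.
Qed.

Lemma dim_rotate U E : is_rotation U -> \dim (rotate U E) = \dim E.
Proof.
move=> [UU _]; apply: limg_dim_eq; apply/eqP; rewrite -subv0; apply/subvP => x.
rewrite memv_cap memv_ker memv0 lfunE/= => /andP[_ /eqP xU].
by rewrite -[x]mulmx1 -UU mulmxA xU mul0mx.
Qed.

Lemma unit_normal_rotate U E th : is_rotation U -> unit_normal E th ->
  unit_normal (rotate U E) (th *m U).
Proof.
move=> rU [t1 tE]; have [UU _] := rU; split.
  by rewrite dotp_mulmx -mulmxA UU mulmx1.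
move=> x; rewrite mem_rotate// => /tE.
by rewrite dotp_mulmx trmxK.
Qed.

(** The orthogonal projector does not depend on the orthonormal basis.  The basis
    of a rotated hyperplane is chosen without regard to the rotation, so this is
    what makes the action of a rotation measurable. *)
Lemma orthonormal_projector m1 m2 (B1 : 'M[R]_(m1, n)) (B2 : 'M[R]_(m2, n)) :
  B1 *m B1^T = 1%:M -> B2 *m B2^T = 1%:M -> (B1 <= B2)%MS -> (B2 <= B1)%MS ->
  B1^T *m B1 = B2^T *m B2.
Proof.
have absorb p q (A : 'M[R]_(p, n)) (B : 'M[R]_(q, n)) : B *m B^T = 1%:M ->
    (A <= B)%MS -> A *m (B^T *m B) = A.
  by move=> BB /submxP[D ->]; rewrite mulmxA -(mulmxA D) BB mulmx1.
move=> B11 B22 s12 s21.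
have e12 : B1^T *m B1 *m (B2^T *m B2) = B1^T *m B1 by rewrite -mulmxA absorb.
have e21 : B2^T *m B2 *m (B1^T *m B1) = B2^T *m B2 by rewrite -mulmxA absorb.
by have := congr1 trmx e12; rewrite !trmx_mul !trmxK e21.
Qed.

Lemma orthoproj_rotate U E : is_rotation U ->
  orthoproj (rotate U E) = U^T *m orthoproj E *m U.
Proof.
move=> rU; have [UU _] := rU.
rewrite /orthoproj !mulmxA -trmx_mul -mulmxA; apply: orthonormal_projector.
- exact: onb_orthonormal.
- by rewrite trmx_mul mulmxA -(mulmxA _ U) UU mulmx1 onb_orthonormal.
- apply/row_subP => i; set x := row i _.
  have : x \in rotate U E by rewrite mem_onb row_sub.
  rewrite mem_rotate// mem_onb => /submxP[D xU].
  apply/submxP; exists D; rewrite mulmxA -xU -mulmxA (mulmx1C UU).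
  by rewrite mulmx1.
- apply/row_subP => i; set x := row i _.
  rewrite -mem_onb mem_rotate// mem_onb /x row_mul -mulmxA UU mulmx1.
  exact: row_sub.
Qed.

(** A rotation preserves the dimension; for other matrices U the value may be the
    default one. *)
Definition hrotate U (E : hyperplane R n) : hyperplane R n :=
  insubd E (rotate U (val E)).

Lemma val_hrotate U (E : hyperplane R n) : is_rotation U ->
  val (hrotate U E) = rotate U (val E).
Proof. by move=> rU; rewrite val_insubd dim_rotate// (valP E). Qed.

Lemma measurable_hrotate U : is_rotation U -> measurable_fun setT (hrotate U).
Proof.
move=> rU _ _ [Z mZ <-].
pose L : 'M[R]_(n * n) := lin_mx (mulmxr U \o mulmx U^T).
exists ((fun x => x *m L) @^-1` Z).
  by rewrite -[X in measurable X]setTI; exact: measurable_mulmx_rV.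
rewrite !setTI; apply/seteqP; split=> E /=;
  by rewrite mul_vec_lin/= val_hrotate// orthoproj_rotate.
Qed.

(** Invariance is stated for direct images; the rotation U^T turns the preimage
    of A under U into such an image. *)
Lemma integral_hrotate U (nu : probability (hyperplane R n) R)
    (h : hyperplane R n -> \bar R) : is_rotation U -> rotation_invariant nu ->
  measurable_fun setT h -> (forall F, (0 <= h F)%E) ->
  (\int[nu]_E h (hrotate U E) = \int[nu]_E h E)%E.
Proof.
move=> rU inv mh h0.
have := ge0_integral_pushforward (measurable_hrotate rU) nu measurableT mh (fun F _ => h0 F).
rewrite preimage_setT => <-; apply: eq_measure_integral => [|mU A mA _].
  exact: measurable_hrotate.
rewrite -[RHS](inv U^T A (is_rotation_tr rU) mA).
congr (nu _); apply/seteqP; split=> E /=.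
  move=> AE; exists (hrotate U E) => //.
  by rewrite val_hrotate// -/(rotate _ _) rotateK.
move=> [F AF EF]; suff -> : hrotate U E = F by [].
apply: val_inj; rewrite val_hrotate// (EF : val E = rotate U^T (val F)).
by have := rotateK (val F) (is_rotation_tr rU); rewrite trmxK.
Qed.

Import HBNNSimple.

(** Rotation invariance lets F be replaced by its average over l, which is at most
    c everywhere.  Since F need not be measurable, its integral
    is a supremum over simple functions h <= F, and it is for h that rotation
    invariance is used. *)
Lemma integral_le_rotations (nu : probability (hyperplane R n) R)
    (F : hyperplane R n -> \bar R) (l : seq 'M[R]_n) (c : R) :
  rotation_invariant nu -> (forall H, (0 <= F H)%E) -> (0 < size l)%N ->
  (forall U, U \in l -> is_rotation U) ->
  (forall H, (\sum_(U <- l) F (hrotate U H) <= ((size l)%:R * c)%:E)%E) ->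
  (\int[nu]_E F E <= c%:E)%E.
Proof.
move=> inv F0 l0 lr lF; rewrite ge0_integralTE//.
apply: ge_ereal_sup => _ [h /= hF <-]; rewrite -integralT_nnsfun.
have N0 : (0 < (size l)%:R%:E :> \bar R)%E by rewrite lte_fin ltr0n.
rewrite -(lee_pmul2l _ N0)//.
pose U i := tnth (in_tuple l) i.
have rU i : is_rotation (U i) by apply: lr; exact: mem_tnth.
have mh : measurable_fun setT (fun H : hyperplane R n => (h H)%:E).
  by apply/measurable_EFinP; exact: measurable_funPT.
have h0 (H : hyperplane R n) : (0 <= (h H)%:E)%E by rewrite lee_fin.
have -> : ((size l)%:R%:E * \int[nu]_E (h E)%:E =
    \int[nu]_E \sum_(i < size l) (h (hrotate (U i) E))%:E)%E.
  rewrite ge0_integral_sum//; last first.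
    move=> i; apply: (measurableT_comp mh); exact: measurable_hrotate.
  under [RHS]eq_bigr do rewrite (integral_hrotate (rU _) inv mh h0).
  by rewrite sumr_const card_ord mule_natl.
rewrite -EFinM -[leRHS]mule1 -(@probability_setT _ _ _ nu) -integral_cst//.
apply: le_integralT => E; first by apply: sume_ge0.
rewrite /=; apply: le_trans (lF E); rewrite [leRHS]big_tnth.
by apply: lee_sum => i _; exact: hF.
Qed.

End rotated_hyperplanes.

Section average_over_frame.
Context {R : realType} (k : nat).
Hypothesis k0 : (0 < k)%N.
Local Notation n := k.+1.
Local Notation lam := (lebesgue_rV R n).
Variables (f lo hi : 'rV[R]_n -> R).
Hypothesis lcf : log_concave f.
Hypothesis fmax : forall x, f x <= f 0.
Hypothesis env : borel_envelopes f lo hi.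
Hypothesis f_int : (\int[lam]_x (f x)%:E = 1)%E.
Hypothesis f_iso : isotropic f.

(** The factor decay^-1 expR 2 bounds the integral of the sup-convolution, and
    56 = 1 / (2 N segment_length sqrt n) with N the number of rotations. *)
Definition projection_constant : R := 56 * (decay^-1 * expR 2).

Local Notation N := (size (@signed_rotations R n)).

Let f0 x : 0 <= f x. Proof. exact: log_concave_ge0. Qed.

(** Chosen so that the zonotope of the frame has radius 1 / (112 n). *)
Let segment_length : R := (112 * N%:R * Num.sqrt n%:R)^-1.

Let N0 : 0 < N%:R :> R. Proof. by rewrite ltr0n size_signed_rotations_gt0. Qed.

Let n0 : 0 < n%:R :> R. Proof. by rewrite ltr0n. Qed.

Let segment_length_gt0 : 0 < segment_length.
Proof. by rewrite invr_gt0 !mulr_gt0// sqrtr_gt0. Qed.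

Let segment_lengthE : segment_length ^+ 2 * N%:R ^+ 2 = (112 ^+ 2 * n%:R)^-1.
Proof.
have N1 : N%:R != 0 :> R by rewrite lt0r_neq0.
rewrite /segment_length -exprMn mulrAC invfM -mulrA mulVf// mulr1.
by rewrite exprVn exprMn sqr_sqrtr// ltW.
Qed.

Let frame (E : {vspace 'rV[R]_n}) (th : 'rV[R]_n) :=
  [seq (rotate U E, th *m U) | U <- @signed_rotations R n].

(** By the tight frame identity and Cauchy-Schwarz, the sum of the |<th U, z>|
    is at most N |z| / sqrt n, so that |z| <= d N / sqrt n.  Cauchy-Schwarz is
    used in the form 2 |a| <= t a^2 + 1 / t, with the weight t that is optimal
    at the extremal norm |z| = d N / sqrt n. *)
Let segment_sum_norm E th z : dotp th th = 1 ->
  segment_sum segment_length (frame E th) z ->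
  dotp z z <= segment_length ^+ 2 * N%:R ^+ 2 / n%:R.
Proof.
move=> t1 /segment_sum_dotp => /(_ z); rewrite /frame big_map/=.
set d := segment_length; have d0 : 0 < d by exact: segment_length_gt0.
pose t := n%:R / (d * N%:R).
have dN : 0 < d * N%:R by exact: mulr_gt0.
have t0 : 0 < t by exact: divr_gt0.
have := signed_rotations_frame z t1.
set Q := \sum_(U <- _) _ ^+ 2 => fr le.
have amgm : \sum_(U <- @signed_rotations R n) `|dotp (th *m U) z| <=
    2^-1 * (t * Q + t^-1 * N%:R).
  have -> : t^-1 * N%:R = \sum_(U <- @signed_rotations R n) t^-1.
    by rewrite big_const_seq count_predT iter_addr_0 mulr_natr.
  rewrite /Q mulr_sumr -big_split/= mulr_sumr; apply: ler_sum => U _.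
  rewrite dotpC; set a := dotp z _; rewrite -[a ^+ 2]real_normK ?num_real//.
  have := sqr_ge0 (t * `|a| - 1); rewrite sqrrB1 exprMn expr2 -mulrA => h.
  rewrite ler_pdivlMl// -[leLHS]mulr1 -(ler_pM2l t0).
  rewrite mulr1 mulrDr divff ?lt0r_neq0//; move: h.
  by set b := `|a|; set q := t * (t * _) => h; lra.
have tQ : t * Q = dotp z z / d.
  have nQ : n%:R * Q = N%:R * dotp z z by [].
  rewrite /t mulrAC nQ invfM mulrA mulrAC (mulrC N%:R) mulfK ?lt0r_neq0//.
have tN : t^-1 * N%:R = d * N%:R ^+ 2 / n%:R.
  by rewrite /t invf_div mulrAC expr2 mulrA.
have := le_trans le (ler_wpM2l (ltW d0) amgm).
rewrite tQ tN.
have -> : d * (2^-1 * (dotp z z / d + d * N%:R ^+ 2 / n%:R)) =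
    2^-1 * (dotp z z + d ^+ 2 * N%:R ^+ 2 / n%:R).
  by rewrite mulrCA mulrDr [d * (_ / d)]mulrC divfK ?lt0r_neq0// !mulrA -expr2.
by set D := dotp z z; set D' := _ / _ => h; lra.
Qed.

(** The zonotope and its thickening stay within distance 1 / (56 n) of the
    origin, so every translate involved is absorbed by the dilation, and the
    integral of the sup-convolution is at most decay^-1 expR 2. *)
Lemma sum_proj_norm1_frame (E : {vspace 'rV[R]_n}) : \dim E = k ->
  (\sum_(U <- @signed_rotations R n) proj_norm1 (rotate U E) f <=
   (N%:R * (projection_constant * Num.sqrt n%:R))%:E)%E.
Proof.
move=> dE; have [th nE] := @unit_normal_exists R n E (eq_ind_r (fun m => m < n)%N (ltnSn k) dE).
have [t1 _] := nE.
pose e : R := (112 * n%:R ^+ 2)^-1.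
have e0 : 0 < e by rewrite invr_gt0 mulr_gt0// exprn_gt0.
have fP p : p \in frame E th -> (1 + \dim p.1)%N = n /\ unit_normal p.1 p.2.
  move=> /mapP[U /signed_rotations_rotation rU ->] /=; split.
    by rewrite dim_rotate// dE.
  exact: unit_normal_rotate.
have := @sum_proj_norm1_le R n f e segment_length f0 e0 segment_length_gt0 _ fP.
rewrite big_map/= => sums.
have d0 : 0 < 2 * segment_length by rewrite mulr_gt0.
rewrite -(lee_pmul2l _ (_ : (0 < (2 * segment_length)%:E)%E))//.
apply: (le_trans sums).
have -> : ((2 * segment_length)%:E *
    (N%:R * (projection_constant * Num.sqrt n%:R))%:E =
    (decay^-1 * expR 2)%:E)%E.
  rewrite -EFinM; congr EFin; rewrite /projection_constant.
  have s0 : Num.sqrt n%:R != 0 :> R by rewrite lt0r_neq0// sqrtr_gt0.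
  have N1 : N%:R != 0 :> R by rewrite lt0r_neq0.
  rewrite /segment_length; set c := decay^-1 * _; set s := Num.sqrt _.
  have -> : 112 = 2 * 56 :> R by rewrite -natrM.
  by field; rewrite N1 s0.
have kn : (k <= n)%N by exact: leqnSn.
have step x : (sup_translates f
    (box_nbhd (segment_sum segment_length (frame E th)) e) x <=
    (decay^-1)%:E * (hi (dilation k *: x))%:E)%E.
  apply: ge_ereal_sup => _ [v [z zs vz] <-].
  rewrite -EFinM lee_fin ler_pdivlMl ?decay_gt0//.
  apply: (@le_trans _ _ (f (dilation k *: x))); last first.
    by case: env => _ _ _ /(_ (dilation k *: x))/andP[].
  apply: (isotropic_dilation k0 lcf fmax env f_int f_iso).
  have zz := segment_sum_norm t1 zs.
  have bb : dotp (v - z) (v - z) <= n%:R * e ^+ 2.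
    rewrite dotpE mulr_natl -[X in _ *+ X]card_ord -sumr_const.
    apply: ler_sum => i _; rewrite -expr2 -[_ ^+ 2]real_normK ?num_real//.
    by apply: lerXn2r; rewrite ?nnegrE ?(ltW e0) ?(ltW (vz i)).
  have vE : z + (v - z) = v by rewrite addrC subrK.
  have := dotpD_le z (v - z); rewrite vE => vv.
  rewrite segment_lengthE in zz; rewrite /e in bb.
  have a1 : 1 <= n%:R :> R by rewrite ler1n.
  have {}kn : k%:R ^+ 2 <= n%:R ^+ 2 :> R.
    by apply: lerXn2r; rewrite ?nnegrE// ler_nat.
  apply: (@le_trans _ _ (n%:R ^+ 2 * (2 * ((112 ^+ 2 * n%:R)^-1 / n%:R) +
      2 * (n%:R * (112 * n%:R ^+ 2)^-1 ^+ 2)))).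
    apply: ler_pM => //; first exact: dotp_ge0.
    apply: le_trans vv _; apply: lerD; exact: ler_wpM2l.
  move: a1 (n0); set a := n%:R => a1 a0.
  have -> : 112 = 2 * 56 :> R by rewrite -natrM.
  have c0 : 56 != 0 :> R by rewrite pnatr_eq0.
  move: c0; set c : R := 56 => c0; clearbody a c.
  have -> : a ^+ 2 * (2 * (((2 * c) ^+ 2 * a)^-1 / a) +
      2 * (a * (2 * c * a ^+ 2)^-1 ^+ 2)) = c^-1 ^+ 2 * (2^-1 * (1 + a^-1)).
    by field; rewrite c0 lt0r_neq0.
  rewrite -[leRHS]mulr1; apply: ler_wpM2l; first exact: sqr_ge0.
  have : a^-1 <= 1 by rewrite invf_le1.
  by move: (a^-1) => b b1; lra.
apply: (le_trans (le_integralT _ _ step)).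
  move=> x; apply: sup_translates_ge0 => //; exists 0.
  by apply: box_nbhd_self => //; exact: segment_sum0.
have mhi : measurable_fun setT (EFin \o hi).
  by apply/measurable_EFinP; case: env.
have hi0 x : (0 <= (EFin \o hi) x)%E.
  rewrite lee_fin; case: env => _ _ lo0 /(_ x)/andP[lf fh] _.
  exact: le_trans (le_trans lf fh).
rewrite ge0_integralZl_EFin//; first last.
- by rewrite invr_ge0 ltW// decay_gt0.
- by apply: (measurableT_comp mhi); exact: measurable_funZ_rV.
- by move=> x _; exact: hi0.
rewrite (ge0_integral_scale (dilation_gt0 k0) mhi hi0)/=.
rewrite (integral_hi_envelope env f_int) mule1 -EFinM lee_fin.
apply: ler_wpM2l; first by rewrite invr_ge0 ltW// decay_gt0.
exact: dilation_jacobian.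
Qed.

End average_over_frame.

Theorem theorem6p5 (R : realType) :
  exists C : R, 0 < C /\
    forall n : nat, (2 <= n)%N ->
    forall nu : probability (hyperplane R n) R, rotation_invariant nu ->
    forall (mu : probability 'rV[R]_n R) (f : 'rV[R]_n -> R),
      log_concave f -> has_density mu f -> isotropic f ->
      (f 0)%:E = ('N[lebesgue_rV R n]_+oo [EFin \o f])%E ->
      (\int[nu]_E proj_norm1 (val E) f <= (C * Num.sqrt n%:R)%:E)%E.
Proof.
exists projection_constant; split.
  apply: mulr_gt0; first by rewrite ltr0n.
  apply: mulr_gt0; last exact: expR_gt0.
  by rewrite invr_gt0; exact: decay_gt0.
move=> [|k]// k0 nu inv mu f lcf [mf fE] f_iso fN.
have f0 := log_concave_ge0 lcf.
have f_int : (\int[lebesgue_rV R k.+1]_x (f x)%:E = 1)%E.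
  by rewrite -(fE setT measurableT) probability_setT.
have fae : {ae lebesgue_rV R k.+1, forall x, f x <= f 0}.
  have := ess_sup_ge (lebesgue_rV R k.+1) (abse \o (EFin \o f)).
  move: fN; rewrite Lnorm.unlock ifT => [<-|].
    by apply: filterS => x /=; rewrite lee_fin; exact: le_trans (ler_norm _).
  apply: (lt_le_trans (lebesgue_rV_ball_gt0 k.+1)).
  by apply: le_measure; rewrite ?inE//; exact: measurable_rV_ball.
have fmax : forall x, f x <= f 0.
  by apply: log_concave_ae_max => //; rewrite f_int.
have [|lo [hi env]] := @borel_envelopes_exist _ _ f (f 0) mf.
  by move=> x; rewrite f0 fmax.
apply: (integral_le_rotations (l := signed_rotations k.+1) inv).
- by move=> E; exact: integral_ge0.
- exact: size_signed_rotations_gt0.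
- exact: signed_rotations_rotation.
move=> E; rewrite (eq_big_seq (fun U => proj_norm1 (rotate U (val E)) f)).
  apply: (sum_proj_norm1_frame k0 lcf fmax env f_int f_iso).
  exact/eqP/(valP E).
by move=> U /signed_rotations_rotation rU; rewrite val_hrotate.
Qed.
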